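(* Let $G$ be a topological group and let $X$ be a minimal $G$-ED flow. Then the following are equivalent: (1) $X$ satisfies the Rosendal criterion. (2) For each symmetric open neighborhood $U$ of $e_G$, $X$ is somewhere $U$-TT. (3) $X$ satisfies the thickness condition. (4) For every set $I$ and every ultrafilter $\mathcal{U}\in\beta I$, the ultracopower $\Sigma_{\mathcal{U}}^G X$ contains a unique minimal subflow. (5) For every set $I$ and every ultrafilter $\mathcal{U}\in\beta I$, the ultracopower map $\pi_{X,\mathcal{U}}\colon \Sigma_{\mathcal{U}}^G X\to X$ is highly proximal. (6) For each $\sigma\in \mathrm{SN}(G)$, the set of $\partial_\sigma$-compatible points is dense in $X$. (7) For each $\sigma\in \mathrm{SN}(G)$, the set of $\overline{\partial}_\sigma$-compatible points is dense in $X/\partial_\sigma$. (8) For some base of semi-norms $\mathcal{B}\subseteq \mathrm{SN}(G)$ and for each $\sigma\in\mathcal{B}$, there is some $\partial_\sigma$-compatible point in $X$. Moreover, the equivalences $(1)\Leftrightarrow(6)\Leftrightarrow(7)$ still hold when the hypothesis that $X$ is minimal is weakened to $X$ being $G$-topologically transitive (i.e. $GB$ is dense in $X$ for every nonempty open $B\subseteq X$).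
   Context: All topological spaces (in particular topological groups) are Hausdorff and regular. For a topological group $G$, a $G$-space is a topological space with a continuous left action $G\times X\to X$, and a $G$-flow is a compact $G$-space. A subflow is a nonempty closed $G$-invariant subset; a flow is minimal if it has no proper subflow. A $G$-map is a continuous $G$-equivariant map. A $G$-space $X$ is $G$-ED ($G$-extremally disconnected) if $\overline{A}\subseteq \mathrm{Int}(\overline{UA})$ for every open $A\subseteq X$ and every neighborhood $U$ of $e_G$. For a symmetric open neighborhood $U$ of $e_G$, a nonempty open $A\subseteq X$ is $U$-TT if $A\subseteq\overline{UB}$ for every nonempty open $B\subseteq A$; a nonempty open $A$ is somewhere $U$-TT if some nonempty open $A_0\subseteq A$ is $U$-TT. $X$ satisfies the Rosendal criterion if for every such $U$, every nonempty open $A\subseteq X$ is somewhere $U$-TT. $X$ satisfies the thickness condition if for every symmetric open neighborhood $U$ of $e_G$ there is a finite $F\subseteq G$ such that $UFA\cap UFB\neq\emptyset$ for all nonempty open $A,B\subseteq X$. $\mathrm{SN}(G)$ is the set of bounded continuous semi-norms on $G$: bounded continuous $\sigma\colon G\to[0,\infty)$ with $\sigma(e_G)=0$, $\sigma(g)=\sigma(g^{-1})$, $\sigma(gh)\le\sigma(g)+\sigma(h)$. Put $\mathrm{B}_\sigma(c)=\{g\in G:\sigma(g)<c\}$. A base of semi-norms is a set $\mathcal{B}\subseteq\mathrm{SN}(G)$ such that $\{\mathrm{B}_\sigma(c):\sigma\in\mathcal{B},c>0\}$ is a neighborhood base at $e_G$. For $\sigma\in\mathrm{SN}(G)$ and $x,y\in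 X$, $\partial_\sigma(x,y)\in[0,\infty]$ is determined by: for $c\in[0,\infty)$, $\partial_\sigma(x,y)\le c$ iff for all $\epsilon>0$ and all open $A\ni x$ we have $y\in\overline{\mathrm{B}_\sigma(c+\epsilon)\cdot A}$. When $X$ is $G$-ED, $\partial_\sigma$ is a lower semi-continuous pseudometric (possibly with value $\infty$). $X/\partial_\sigma$ is the compact quotient of $X$ by the closed equivalence relation $\partial_\sigma(x,y)=0$, with the induced lower semi-continuous metric $\overline{\partial}_\sigma$. For a pseudometric $\partial$ on a space $Y$, a point $y\in Y$ is $\partial$-compatible if $y\in\mathrm{Int}(\{z\in Y:\partial(y,z)<c\})$ for every $c>0$. Ultracopowers: let $X$ be a $G$-ED flow and $I$ a (discrete) set. $I\times X$ is a $G$-space via $g(i,x)=(i,gx)$. Let $\mathrm{S}_G(I\times X)$ be its universal $G$-equivariant compactification: a $G$-flow containing $I\times X$ as a dense $G$-subspace such that every $G$-map from $I\times X$ to a $G$-flow extends to a $G$-map on $\mathrm{S}_G(I\times X)$. The projections extend to continuous maps $\pi_I\colon\mathrm{S}_G(I\times X)\to\beta I$ and $\pi_X\colon\mathrm{S}_G(I\times X)\to X$. For $\mathcal{U}\in\beta I$, $\Sigma^G_{\mathcal{U}}X:=\pi_I^{-1}(\{\mathcal{U}\})$ is the ultracopower and $\pi_{X,\mathcal{U}}:=\pi_X|_{\Sigma^G_{\mathcal{U}}X}$ is the ultracopower map. A surjective $G$-map $\pi\colon Y\to X$ of $G$-flows is highly proximal if for every $x\in X$ there is a net $(g_i)$ from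 $G$ such that $g_i\cdot\pi^{-1}[x]$ converges to a singleton in the Vietoris topology on the space of nonempty compact subsets of $Y$. *)

(* Defs.v *)
From HB Require Import structures.
From mathcomp Require Import all_boot all_order all_algebra.
From mathcomp Require Import all_classical all_reals.
From mathcomp Require Import topology ereal normedtype.
From mathcomp Require Import lra.

Set Implicit Arguments.
Unset Strict Implicit.
Unset Printing Implicit Defensive.

Import Order.TTheory GRing.Theory Num.Theory.
Import numFieldNormedType.Exports.

Local Open Scope classical_set_scope.
Local Open Scope ring_scope.

HB.mixin Record isTopologicalGroup G & Group G & Topological G := {
  mulg_continuous : continuous (fun p : G * G => (p.1 * p.2)%g) ;
  invg_continuous : continuous (fun g : G => g^-1%g)
}.

#[short(type="topologicalGroupType")]
HB.structure Definition TopologicalGroup :=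
  {G of Group G & Topological G & isTopologicalGroup G}.

Record gspace (G : topologicalGroupType) := GSpace {
  gcarrier :> topologicalType ;
  gact : G -> gcarrier -> gcarrier ;
  gact1 : forall x, gact 1%g x = x ;
  gactM : forall g h x, gact (g * h)%g x = gact g (gact h x) ;
  gact_continuous : continuous (fun p : G * gcarrier => gact p.1 p.2) ;
  gspace_hausdorff : hausdorff_space gcarrier ;
  gspace_regular : regular_space gcarrier
}.

Section GSpaceTheory.
Context {G : topologicalGroupType}.

Definition gmap (X Y : gspace G) (f : X -> Y) : Prop :=
  continuous f /\ forall g x, f (gact g x) = gact g (f x).

Definition gflow (X : gspace G) : Prop := compact [set: X].

Definition setact {X : gspace G} (U : set G) (A : set X) : set X :=
  [set gact g x | g in U & x in A].

Definition subflow {X : gspace G} (A : set X) : Prop :=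
  [/\ A !=set0, closed A & forall g x, A x -> A (gact g x)].

Definition minimal_subflow {X : gspace G} (M : set X) : Prop :=
  subflow M /\ forall N, subflow N -> N `<=` M -> N = M.

(* subflow requires nonemptiness, so the empty flow is not minimal *)
Definition minimal (X : gspace G) : Prop := minimal_subflow [set: X].

Definition topologically_transitive (X : gspace G) : Prop :=
  forall B : set X, open B -> B !=set0 -> dense (setact [set: G] B).

Definition symmetric_nbhd (U : set G) : Prop :=
  [/\ open U, U 1%g & forall g, U g -> U g^-1%g].

Definition GED (X : gspace G) : Prop :=
  forall (A : set X) (U : set G), open A -> nbhs (1%g : G) U ->
    closure A `<=` interior (closure (setact U A)).

Definition TT {X : gspace G} (U : set G) (A : set X) : Prop :=
  [/\ open A, A !=set0 &
      forall B : set X, open B -> B !=set0 -> B `<=` A ->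
        A `<=` closure (setact U B)].

Definition somewhere_TT {X : gspace G} (U : set G) (A : set X) : Prop :=
  exists2 A0 : set X, A0 `<=` A & TT U A0.

Definition rosendal_criterion (X : gspace G) : Prop :=
  forall U : set G, symmetric_nbhd U ->
  forall A : set X, open A -> A !=set0 -> somewhere_TT U A.

Definition thickness_condition (X : gspace G) : Prop :=
  forall U : set G, symmetric_nbhd U ->
  exists2 F : set G, finite_set F &
  forall A B : set X, open A -> A !=set0 -> open B -> B !=set0 ->
    setact U (setact F A) `&` setact U (setact F B) !=set0.

End GSpaceTheory.

Section GSpaceLemmas.
Context {G : topologicalGroupType} {X : gspace G}.

Lemma gactK g : cancel (@gact G X g) (gact g^-1%g).
Proof. by move=> x; rewrite -gactM mulVg gact1. Qed.

Lemma gact_continuousr g : continuous (@gact G X g).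
Proof.
move=> x; apply: (@continuous_comp X (G * X)%type X (fun x => (g, x))
  (fun p => gact p.1 p.2)); last exact: gact_continuous.
by apply: cvg_pair; [exact: cvg_cst|exact: cvg_id].
Qed.

Lemma gact_open g (A : set X) : open A -> open (gact g @` A).
Proof.
move=> oA; rewrite (_ : _ @` _ = @gact G X g^-1%g @^-1` A).
  by move/continuousP: (@gact_continuousr g^-1%g); exact.
rewrite eqEsubset; split=> [_ [a Aa <-]|x Ax]; first by rewrite /preimage /= gactK.
by exists (gact g^-1%g x) => //; rewrite -gactM mulgV gact1.
Qed.

Lemma setactS (U V : set G) (A B : set X) :
  U `<=` V -> A `<=` B -> setact U A `<=` setact V B.
Proof. by move=> UV AB _ [g Ug [x Ax <-]]; exists g; [exact: UV|exists x; [exact: AB|]]. Qed.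

Lemma setact_closure (U : set G) (A : set X) :
  setact U (closure A) `<=` closure (setact U A).
Proof.
move=> _ [g Ug [x Ax <-]] V /(gact_continuousr (x := x)) gV.
have [y [Ay Vy]] := Ax _ gV.
by exists (gact g y); split => //; exists g => //; exists y.
Qed.

End GSpaceLemmas.

Definition SN (R : realType) (G : topologicalGroupType) : set (G -> R) :=
  [set s : G -> R | [/\ continuous s,
               (exists M, forall g, s g <= M) /\ (forall g, 0 <= s g),
               s 1%g = 0,
               forall g, s g^-1%g = s g &
               forall g h, s (g * h)%g <= s g + s h]].

Definition sball {R : realType} {G : topologicalGroupType} (s : G -> R) (c : R) :
  set G := [set g | s g < c].

Definition seminorm_base {R : realType} {G : topologicalGroupType}
    (B : set (G -> R)) : Prop :=
  [/\ B `<=` @SN R G,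
      forall s c, B s -> 0 < c -> nbhs (1%g : G) (sball s c) &
      forall V, nbhs (1%g : G) V ->
        exists s c, [/\ B s, 0 < c & sball s c `<=` V]].

Section Pseudometric.
Context {R : realType} {G : topologicalGroupType} {X : gspace G}.
Implicit Types (s : G -> R) (c : R) (x y z : X).

Definition dsn_le s c x y : Prop :=
  forall e, 0 < e -> forall A : set X, open A -> A x ->
    closure (setact (sball s (c + e)) A) y.

(* The least c >= 0 such that dsn_le s c x y (see dsnP), +oo if there is none *)
Definition dsn s x y : \bar R :=
  ereal_inf [set c%:E | c in [set c | 0 <= c /\ dsn_le s c x y]].

Lemma dsn_le_weak s c d x y : c <= d -> dsn_le s c x y -> dsn_le s d x y.
Proof.
move=> cd cxy e e0 A oA Ax; apply: closure_subset (cxy _ e0 _ oA Ax).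
apply: setactS => // g; rewrite /sball /= => /lt_le_trans; apply.
by rewrite lerD2r.
Qed.

Lemma dsnP s c x y : 0 <= c -> (dsn s x y <= c%:E)%E <-> dsn_le s c x y.
Proof.
move=> c0; split; last by move=> cxy; apply: ereal_inf_lbound; exists c.
move=> dc e e0 A oA Ax.
have : (dsn s x y < (c + e / 2)%:E)%E.
  by apply: le_lt_trans dc _; rewrite lte_fin ltrDl divr_gt0.
move=> /ereal_inf_lt[_ [d [d0 dxy] <-]]; rewrite lte_fin => /ltW dce.
have e20 : 0 < e / 2 by rewrite divr_gt0.
by have := dsn_le_weak dce dxy e20 oA Ax; rewrite -addrA -splitr.
Qed.

Lemma dsn_ge0 s x y : (0 <= dsn s x y)%E.
Proof. by apply: le_ereal_inf_tmp => _ [c [c0 _] <-]; rewrite lee_fin. Qed.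

Lemma dsn0P s x y : dsn s x y = 0%E <-> dsn_le s 0 x y.
Proof.
rewrite -dsnP//; split => [->//|d0].
by apply/eqP; rewrite eq_le d0 dsn_ge0.
Qed.

Section Properties.
Local Open Scope quotient_scope.
Variable s : G -> R.
Hypothesis sSN : SN s.

Lemma nbhs_sball e : 0 < e -> nbhs (1%g : G) (sball s e).
Proof.
case: sSN => cs _ s1 _ _ e0.
have : nbhs (s 1%g) [set t | t < e] by rewrite s1; exact: lt_nbhsl.
exact: cs.
Qed.

Lemma dsn_le_refl x : dsn_le s 0 x x.
Proof.
move=> e e0 A oA Ax; apply: subset_closure.
exists 1%g; last by exists x => //; rewrite gact1.
by apply: nbhs_singleton; apply: nbhs_sball; rewrite add0r.
Qed.

Lemma dsn_le_sym c x y : dsn_le s c x y -> dsn_le s c y x.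
Proof.
case: sSN => _ _ _ sV _ cxy e e0 B oB By; apply: contrapT => nx.
have oA : open (~` closure (setact (sball s (c + e)) B)).
  by apply: closed_openC; exact: closed_closure.
have /(_ B) := cxy e e0 _ oA nx.
case=> [|_ [[g sg [a Aa <-]] Bga]]; first exact: open_nbhs_nbhs.
apply: Aa; apply: subset_closure; exists g^-1%g; first by rewrite /sball /= sV.
by exists (gact g a) => //; rewrite gactK.
Qed.

Lemma dsn_le_trans c d x y z : GED X ->
  dsn_le s c x y -> dsn_le s d y z -> dsn_le s (c + d) x z.
Proof.
case: sSN => _ _ _ _ sD ed cxy dyz e e0 A oA Ax.
pose d3 := e / 2 / 2; have d30 : 0 < d3 by rewrite !divr_gt0.
have eE : e = d3 + d3 + (e / 2) by rewrite /d3 -!splitr.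
have e20 : 0 < e / 2 by rewrite divr_gt0.
pose W := sball s d3.
have Wnb : nbhs (1%g : G) W by exact: nbhs_sball.
have oC : open (setact (sball s (c + d3)) A).
  rewrite (_ : setact _ _ = \bigcup_(g in sball s (c + d3)) (gact g @` A)).
    by apply: bigcup_open => g _; exact: gact_open.
  rewrite eqEsubset; split=> [_ [g sg [a Aa <-]]|_ [g sg [a Aa <-]]].
    by exists g => //; exists a.
  by exists g => //; exists a.
have Vy : interior (closure (setact W (setact (sball s (c + d3)) A))) y.
  by apply: (ed _ _ oC Wnb); exact: (cxy _ d30 _ oA Ax).
have := dyz _ e20 _ (open_interior _) Vy.
have ccl (B : set X) : closure (closure B) `<=` closure B.
  by rewrite -(closure_id _).1//; exact: closed_closure.
move=> h; apply: ccl; move: h; apply: closure_subset => _ [g sg [t /interior_subset tA <-]].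
have := setact_closure (ex_intro2 _ _ g sg (ex_intro2 _ _ t tA erefl)).
apply: closure_subset => _ [g1 sg1 [_ [g2 sg2 [_ [g3 sg3 [a Aa <-]] <-]] <-]].
exists (g1 * (g2 * g3))%g; last by exists a => //; rewrite !gactM.
rewrite /sball /=; apply: le_lt_trans (sD _ _) _.
apply: le_lt_trans (lerD (lexx _) (sD _ _)) _.
move: sg1 sg2 sg3; rewrite /W /sball /= => sg1 sg2 sg3.
clear -sg1 sg2 sg3 eE; clearbody d3; lra.
Qed.

Hypothesis ed : GED X.

Definition dsn0 x y : bool := `[< dsn s x y = 0%E >].

Lemma dsn0_refl : reflexive dsn0.
Proof. by move=> x; apply/asboolP/dsn0P; exact: dsn_le_refl. Qed.

Lemma dsn0_sym : symmetric dsn0.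
Proof. by move=> x y; apply/asboolP/asboolP => /dsn0P/dsn_le_sym/dsn0P. Qed.

Lemma dsn0_trans : transitive dsn0.
Proof.
move=> y x z /asboolP/dsn0P xy /asboolP/dsn0P yz; apply/asboolP/dsn0P.
by rewrite -(addr0 0); exact: dsn_le_trans xy yz.
Qed.

Definition dsn_equiv : equiv_rel X := EquivRel dsn0 dsn0_refl dsn0_sym dsn0_trans.

Definition dsn_quotient : topologicalType :=
  quotient_topology {eq_quot dsn_equiv}.

Definition dsn_class : X -> dsn_quotient := \pi_{eq_quot dsn_equiv}.

Definition dsn_bar (p q : dsn_quotient) : \bar R :=
  dsn s (repr (p : {eq_quot dsn_equiv})) (repr (q : {eq_quot dsn_equiv})).

Lemma dsn0_dsn_le x x' y y' : dsn0 x x' -> dsn0 y y' ->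
  (dsn s x y <= dsn s x' y')%E.
Proof.
move=> /asboolP/dsn0P xx' /asboolP/dsn0P/dsn_le_sym y'y.
apply: le_ereal_inf_tmp => _ [c [c0 x'y'] <-]; apply/dsnP => //.
by rewrite -(addr0 c) -(add0r c); apply: dsn_le_trans y'y => //; exact: dsn_le_trans x'y'.
Qed.

Lemma dsn_barE x y : dsn_bar (dsn_class x) (dsn_class y) = dsn s x y.
Proof.
have reprE z : dsn0 (repr (\pi_{eq_quot dsn_equiv} z)) z.
  by apply/(@eqmodP _ dsn_equiv); rewrite reprK.
apply/eqP; rewrite eq_le; apply/andP; split; apply: dsn0_dsn_le.
- exact: reprE.
- exact: reprE.
- by rewrite dsn0_sym; exact: reprE.
- by rewrite dsn0_sym; exact: reprE.
Qed.

End Properties.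
End Pseudometric.

Arguments dsn_class {R G X s} sSN ed x.
Arguments dsn_bar {R G X s} sSN ed p q.

Definition compatible {R : realType} {Y : topologicalType} (d : Y -> Y -> \bar R) :
  set Y := [set y | forall c : R, 0 < c -> interior [set z | (d y z < c%:E)%E] y].

(* Stone-Cech compactification of the discrete space I *)
Record beta (I : Type) := Beta {
  beta_sets :> set_system I ;
  beta_ultra : UltraFilter beta_sets
}.
#[global] Existing Instance beta_ultra.

HB.instance Definition _ (I : Type) := gen_eqMixin (beta I).
HB.instance Definition _ (I : Type) := gen_choiceMixin (beta I).

Section BetaTopology.
Context {I : Type}.

Definition beta_base (A : set I) : set (beta I) := [set U | beta_sets U A].

Lemma beta_base_cover : \bigcup_(A in [set: set I]) beta_base A = setT.
Proof.
by rewrite -subTset => U _; exists setT => //; rewrite /beta_base /=; exact: filterT.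
Qed.

Lemma beta_base_join (A B : set I) (U : beta I) : [set: set I] A -> [set: set I] B ->
  beta_base A U -> beta_base B U ->
  exists C, [/\ [set: set I] C, beta_base C U &
                beta_base C `<=` beta_base A `&` beta_base B].
Proof.
move=> _ _ UA UB; exists (A `&` B); split => //; first exact: filterI.
by move=> V VAB; split; apply: filterS VAB => i [].
Qed.

HB.instance Definition _ :=
  isBaseTopological.Build (beta I) beta_base_cover beta_base_join.

Definition beta_principal (i : I) : beta I :=
  Beta (principal_filter_ultra i).

End BetaTopology.

Section ProductSpace.
Context {G : topologicalGroupType}.
Variables (I : Type) (X : gspace G).

Local Notation disc := (discrete_topology {classic I}).

Definition prod_act (g : G) (p : disc * X) : disc * X := (p.1, gact g p.2).

Lemma prod_act1 p : prod_act 1%g p = p.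
Proof. by case: p => i x; rewrite /prod_act /= gact1. Qed.

Lemma prod_actM g h p : prod_act (g * h)%g p = prod_act g (prod_act h p).
Proof. by rewrite /prod_act /= gactM. Qed.

Lemma prod_act_continuous :
  continuous (fun q : G * (disc * X) => prod_act q.1 q.2).
Proof.
move=> [g [i x]].
have c2 : continuous (fun q : G * (disc * X) => (q.1, q.2.2)).
  move=> q; apply: (@cvg_pair _ _ _ _ (nbhs q.1) (nbhs q.2.2)); first exact: cvg_fst.
  by apply: (@continuous_comp _ _ _ snd snd); exact: cvg_snd.
apply: (@cvg_pair _ _ _ _ (nbhs i) (nbhs (gact g x))).
  apply: (cvg_comp (snd : G * (disc * X) -> disc * X) fst); first exact: cvg_snd.
  exact: cvg_fst.
apply: (cvg_comp (fun q : G * (disc * X) => (q.1, q.2.2)) (fun p => gact p.1 p.2)).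
  exact: c2.
exact: (@gact_continuous G X (g, x)).
Qed.

Lemma prod_hausdorff : hausdorff_space (disc * X)%type.
Proof.
move=> [i x] [j y] cl.
have ij : i = j.
  have [||[k z] [/= [-> _] [-> _]]//] :=
    cl ([set i] `*` setT) ([set j] `*` setT).
  - exists ([set i], setT) => //; split; [exact: discrete_set1|exact: filterT].
  - exists ([set j], setT) => //; split; [exact: discrete_set1|exact: filterT].
congr (_, _) => //; apply: (@gspace_hausdorff _ X) => A B Ax By.
have [||[k z] [/= [_ ?] [_ ?]]] := cl (setT `*` A) (setT `*` B).
- by exists (setT, A) => //; split => //; exact: filterT.
- by exists (setT, B) => //; split => //; exact: filterT.
by exists z.
Qed.

Lemma prod_regular : regular_space (disc * X)%type.
Proof.
move=> [i x] V [[A B] [/= Ai Bx] ABV].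
have [C Cx CB] := @gspace_regular _ X x B Bx.
exists ([set i] `*` C).
  by exists ([set i], C) => //; split => //; exact: discrete_set1.
move=> [j y] cl; apply: ABV; split => /=.
  have [|[k z] [/= [-> _] [<- _]]] := cl ([set j] `*` setT).
    by exists ([set j], setT) => //; split; [exact: discrete_set1|exact: filterT].
  exact: nbhs_singleton Ai.
apply: CB => D Dy.
have [|[k z] [/= [_ ?] [_ ?]]] := cl (setT `*` D).
  by exists (setT, D) => //; split => //; exact: filterT.
by exists z.
Qed.

Definition gprod : gspace G :=
  GSpace prod_act1 prod_actM prod_act_continuous prod_hausdorff prod_regular.

End ProductSpace.

Section Compactification.
Context {G : topologicalGroupType}.

Definition topological_embedding (Z S : topologicalType) (j : Z -> S) : Prop :=
  injective j /\
  forall A : set Z, open A <-> exists2 B : set S, open B & A = j @^-1` B.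

Definition universal_compactification (Z S : gspace G) (j : Z -> S) : Prop :=
  [/\ gflow S, gmap j, topological_embedding j, dense (range j) &
      forall (Y : gspace G) (f : Z -> Y), gflow Y -> gmap f ->
        exists2 h : S -> Y, gmap h & forall z, h (j z) = f z].

(* S_G(I x X) together with the extensions of the two projections; all of it *)
(* is determined by I and X up to a unique isomorphism.                      *)
Record SG (I : Type) (X : gspace G) := MkSG {
  SG_space :> gspace G ;
  SG_inj : gprod I X -> SG_space ;
  SG_universal : universal_compactification SG_inj ;
  SG_fst : SG_space -> beta I ;
  SG_fst_continuous : continuous SG_fst ;
  SG_fstE : forall i x, SG_fst (SG_inj (i, x)) = beta_principal i ;
  SG_snd : SG_space -> X ;
  SG_snd_continuous : continuous SG_snd ;
  SG_sndE : forall i x, SG_snd (SG_inj (i, x)) = x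
}.

Definition ultracopower (I : Type) (X : gspace G) (S : SG I X) (U : beta I) :
  set S := @SG_fst I X S @^-1` [set U].

End Compactification.

Arguments SG_fst {G I X} s.
Arguments SG_snd {G I X} s.
Arguments ultracopower {G I X} S U.

(* the space of nonempty compact subsets of Y, with the Vietoris topology *)
Record hyperspace (Y : topologicalType) := Hyperspace {
  hyper_set :> set Y ;
  hyper_neq0 : hyper_set !=set0 ;
  hyper_compact : compact hyper_set
}.

HB.instance Definition _ (Y : topologicalType) := gen_eqMixin (hyperspace Y).
HB.instance Definition _ (Y : topologicalType) := gen_choiceMixin (hyperspace Y).

Section Vietoris.
Context {Y : topologicalType}.

Definition vietoris_subbase (i : bool * set Y) : set (hyperspace Y) :=
  if i.1 then [set K | (K : hyperspace Y) `<=` i.2]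
  else [set K | (K : hyperspace Y) `&` i.2 !=set0].

HB.instance Definition _ := isSubBaseTopological.Build (hyperspace Y)
  [set i : bool * set Y | open i.2] vietoris_subbase.

Definition hyper1 (y : Y) : hyperspace Y :=
  Hyperspace (ex_intro _ y erefl) (@compact_set1 Y y).

End Vietoris.

Section Nets.

Definition directed (D : Type) (le : D -> D -> Prop) : Prop :=
  [/\ inhabited D, forall a, le a a,
      forall a b c, le a b -> le b c -> le a c &
      forall a b, exists2 c, le a c & le b c].

Definition net_cvg (D : Type) (le : D -> D -> Prop) (T : topologicalType)
    (u : D -> T) (t : T) : Prop :=
  forall V, nbhs t V -> exists d0, forall d, le d0 d -> V (u d).

End Nets.

Section HighlyProximal.
Context {G : topologicalGroupType}.

Lemma hyper_act_neq0 (Y : gspace G) g (K : hyperspace Y) :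
  @gact G Y g @` K !=set0.
Proof. by have [y Ky] := hyper_neq0 K; exists (gact g y); exists y. Qed.

Lemma hyper_act_compact (Y : gspace G) g (K : hyperspace Y) :
  compact (@gact G Y g @` K).
Proof.
apply: continuous_compact; last exact: hyper_compact.
by apply: continuous_subspaceT; exact: gact_continuousr.
Qed.

Definition hyper_act (Y : gspace G) (g : G) (K : hyperspace Y) : hyperspace Y :=
  Hyperspace (@hyper_act_neq0 Y g K) (@hyper_act_compact Y g K).

(* Relative to a closed G-invariant subset A of a flow Y: the restriction of  *)
(* pi to A is a highly proximal map from the flow A onto X. The Vietoris      *)
(* topology on the compact subsets of A is the one induced by hyperspace Y.   *)
Definition highly_proximal (Y X : gspace G) (A : set Y) (pi : Y -> X) : Prop :=
  [/\ {within A, continuous pi},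
      forall g y, A y -> pi (gact g y) = gact g (pi y),
      pi @` A = [set: X] &
      forall x, exists2 K : hyperspace Y, hyper_set K = A `&` pi @^-1` [set x] &
        exists (D : Type) (le : D -> D -> Prop) (g : D -> G) (y : Y),
          directed le /\ net_cvg le (fun d => hyper_act (g d) K) (hyper1 y)].

End HighlyProximal.

(* Main.v *)
(** (1), (2), (3) are equivalent by direct manipulation of open sets: finitely many
    translates of a U-TT set cover a minimal flow, and when no open set is U-TT,
    finitely many shrinkings of two open sets contradict thickness. (6) and (7) are
    equivalent to (1) by a Baire category argument and by saturating open sets along
    the seminorm pseudometric; together with (8) this needs that every neighbourhood
    of the identity contains the unit ball of a continuous semi-norm
    (Birkhoff-Kakutani). Thickness separates any two disjoint subflows of an
    ultracopower layer by layer. Conversely, if thickness fails for U, take the finite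
    subsets F of G as layers, with open sets A_F, B_F such that UFA_F and UFB_F are
    disjoint. In a G-ED flow the distance to F.A_F for a semi-norm is continuous, so
    the layerwise distances form a function on I x X that is uniformly continuous
    along the action. It extends to S_G(I x X), realized as the closure of I x X in
    the cube of all such functions, and separates two minimal subflows of the
    ultracopower. A U-TT set in X turns uniqueness of the minimal subflow into high
    proximality, and the limit point of a contracted fibre lies in every subflow. *)
Require Import Defs.
From mathcomp Require Import all_boot all_order all_algebra.
From mathcomp Require Import finmap all_classical all_reals.
From mathcomp Require Import topology ereal normedtype.
From mathcomp Require Import lra.

Set Implicit Arguments.
Unset Strict Implicit.
Unset Printing Implicit Defensive.

Import Order.TTheory GRing.Theory Num.Theory.
Import numFieldNormedType.Exports.

Local Open Scope classical_set_scope.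
Local Open Scope ring_scope.

(** * Topological preliminaries *)

Lemma filter_finite_bigcap (I T : Type) (F : set_system T) (D : set I)
    (f : I -> set T) : Filter F -> finite_set D ->
  (forall i, D i -> F (f i)) -> F (\bigcap_(i in D) f i).
Proof.
elim/Pchoice: I => I in D f * => FF /finite_fsetP[E ->] Ef.
by apply: filter_bigI => i iE; exact: Ef.
Qed.

(** The tails of the directed set of finite subsets. They serve to extract finite subcovers and,
    later, to index the layers of an ultracopower by the subsets of [G]. *)
Lemma finite_sets_filter (I : Type) : exists FF : set_system (set I),
  [/\ ProperFilter FF, FF (@finite_set I) & forall i, FF [set F | F i]].
Proof.
exists (filter_from (@finite_set I) (fun F => [set E | finite_set E /\ F `<=` E])).
split.
- apply: filter_from_proper; last by move=> F fF; exists F; split.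
  apply: filter_from_filter; first by exists set0; exact: finite_set0.
  move=> E F fE fF; exists (E `|` F); first by rewrite finite_setU.
  by move=> J [fJ EFJ]; split; split => // i ?; apply: EFJ; [left|right].
- by exists set0; [exact: finite_set0|move=> E []].
- by move=> i; exists [set i] => [|E [_ iE]]; [exact: finite_set1|exact: iE].
Qed.

Section General_topology.
Implicit Types T : topologicalType.

Lemma closure_openP T (A : set T) x :
  closure A x <-> forall B, open B -> B x -> A `&` B !=set0.
Proof.
split=> [cA B oB Bx|cA B]; first by apply: cA; exact: open_nbhs_nbhs.
by rewrite nbhsE => -[C [oC Cx] CB]; have [y [Ay Cy]] := cA _ oC Cx; exists y;
  split => //; exact: CB.
Qed.

Lemma closureK T (A : set T) : closure (closure A) = closure A.
Proof. by rewrite -(closure_id _).1//; exact: closed_closure. Qed.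

(** Near each point one index suffices, so the near-covering property along the filter of finite
    index sets gives one finite set for all of [K]. *)
Lemma compact_finite_cover T (K : set T) (I : Type) (f : I -> set T) :
  compact K -> (forall i, open (f i)) -> K `<=` \bigcup_i f i ->
  exists2 F : set I, finite_set F & K `<=` \bigcup_(i in F) f i.
Proof.
move=> /compact_near_coveringP cK fo Kf.
have [FF [PF FFfin FFi]] := finite_sets_filter I.
have : FF (@finite_set I `&` [set E | K `<=` \bigcup_(i in E) f i]).
  apply: filterI => //.
  apply: (cK _ FF (fun E x => (\bigcup_(i in E) f i) x)) => x Kx; have [i _ fix_] := Kf _ Kx.
  exists (f i, [set E | E i]); first by split=> //=; exact: open_nbhs_nbhs.
  by move=> [y E] [/= fy Ei]; exists i.
by move=> /filter_ex[E [fE KE]]; exists E.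
Qed.

Lemma hausdorff_closed1 T (x : T) : hausdorff_space T -> closed [set x].
Proof. by move=> hT; exact: compact_closed (@compact_set1 _ x). Qed.

Lemma compact_closed_chain T (K : set T) (F : set (set T)) : compact K -> F !=set0 ->
  (forall A, F A -> [/\ closed A, A `<=` K & A !=set0]) -> total_on F subset ->
  \bigcap_(A in F) A !=set0.
Proof.
move=> cK [A0 FA0] HF totF.
have PF : ProperFilter (filter_from F id).
  apply: filter_from_proper; last by move=> A /HF[].
  apply: filter_from_filter; first by exists A0.
  by move=> A B FA FB; have [AB|BA] := totF _ _ FA FB;
    [exists A|exists B] => // x ?; split => //; [exact: AB|exact: BA].
have [|x [_ Fx]] := cK _ PF; first by exists A0 => //; have [] := HF _ FA0.
exists x => A FA; have [cA _ _] := HF _ FA; apply: cA => B Bx.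
by apply: Fx => //; exists A.
Qed.

Lemma eq_on_dense T T' (f g : T -> T') (D : set T) : hausdorff_space T' ->
  dense D -> continuous f -> continuous g -> (forall x, D x -> f x = g x) -> f =1 g.
Proof.
move=> hT dD cf cg fg x; apply: hT => A B Afx Bgx.
have : nbhs x (f @^-1` A `&` g @^-1` B) by apply: filterI; [exact: cf|exact: cg].
rewrite nbhsE => -[C [oC Cx] CAB].
have [|y [Cy Dy]] := dD C _ oC; first by exists x.
by exists (f y); split; [exact: (CAB y Cy).1|rewrite fg//; exact: (CAB y Cy).2].
Qed.

(** Regularity shrinks an open set to one whose closure lies in it and in [O n]; the nested closures
    have a common point by compactness. *)
Lemma compact_hausdorff_baire T (O : nat -> set T) : compact [set: T] ->
  hausdorff_space T -> (forall n, open (O n)) -> (forall n, dense (O n)) ->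
  dense (\bigcap_n O n).
Proof.
move=> cT hT oO dO A [a Aa] oA.
have reg : regular_space T.
  by move=> x; apply: compact_regular hT cT _; exact: filterT.
have step (n : nat) (B : set T) : open B /\ B !=set0 ->
    exists C, [/\ open C, C !=set0 & closure C `<=` B `&` O n].
  move=> [oB B0]; have [x [Bx Ox]] := dO n _ B0 oB.
  have [|C Cx CB] := reg x (B `&` O n).
    by apply: open_nbhs_nbhs; split => //; exact: openI.
  exists C°; split; [exact: open_interior| by exists x; exact: Cx|].
  by apply: subset_trans CB; apply: closureS; exact: interior_subset.
(* The default value [B] is never met along the sequence, whose members all stay open and
   nonempty. *)
pose next (n : nat) (B : set T) : set T :=
  if pselect (open B /\ B !=set0) is left H then projT1 (cid (step n B H)) else B.
have nextP n B : open B /\ B !=set0 ->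
    [/\ open (next n B), next n B !=set0 & closure (next n B) `<=` B `&` O n].
  by move=> H; rewrite /next; case: pselect => // H'; case: (cid _).
pose B := fix B n := if n is n'.+1 then next n' (B n') else A.
have oB n : open (B n) /\ B n !=set0.
  by elim: n => [|n /(nextP n)[]]//; split => //; exists a.
have BS n : closure (B n.+1) `<=` B n `&` O n by have [] := nextP n _ (oB n).
have Bdec m n : (m <= n)%N -> B n `<=` B m.
  elim: n => [|n IH]; first by rewrite leqn0 => /eqP->.
  rewrite leq_eqVlt => /orP[/eqP->//|/IH]; apply: subset_trans => x Bx.
  by have [] := BS n x (subset_closure Bx).
have [|_ [n _ <-]|_ _ [m _ <-] [n _ <-]|x Fx] :=
    @compact_closed_chain T setT [set closure (B n.+1) | n in [set: nat]] cT.
- by exists (closure (B 1)); exists 0%N.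
- split=> //; first exact: closed_closure.
  by have [_ [y By]] := oB n.+1; exists y; exact: subset_closure.
- by case: (leqP m n) => [mn|/ltnW mn]; [right|left]; apply: closureS; exact: Bdec.
exists x; split; first by have [] := BS 0%N x (Fx _ (ex_intro2 _ _ 0%N I erefl)).
by move=> n _; have [] := BS n x (Fx _ (ex_intro2 _ _ n I erefl)).
Qed.

End General_topology.

(** * Rosendal criterion and thickness *)

Section Groups.
Context {G : topologicalGroupType}.
Implicit Types (U V W : set G) (F : set G).

Lemma symmetric_nbhd_nbhs U : symmetric_nbhd U -> nbhs (1%g : G) U.
Proof. by case=> oU U1 _; exact: open_nbhs_nbhs. Qed.

Lemma mulg_cvg (g h : G) : (fun p : G * G => (p.1 * p.2)%g) @ (g, h) --> (g * h)%g.
Proof. exact: (@mulg_continuous G (g, h)). Qed.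

Lemma mulg_continuousl (h : G) : continuous (fun g : G => (g * h)%g).
Proof.
move=> g; apply: (cvg_comp2 cvg_id (@cvg_cst _ h _ _ _) (@mulg_cvg g h)).
Qed.

Lemma mulg_continuousr (h : G) : continuous (fun g : G => (h * g)%g).
Proof.
move=> g; apply: (cvg_comp2 (@cvg_cst _ h _ _ _) cvg_id (@mulg_cvg h g)).
Qed.

Lemma symmetric_nbhd_sub V : nbhs (1%g : G) V ->
  exists2 W, symmetric_nbhd W & W `<=` V.
Proof.
move=> V1; exists (V° `&` (fun g => g^-1%g) @^-1` V°); last first.
  by move=> g [/interior_subset].
split.
- apply: openI; first exact: open_interior.
  by apply: open_comp (open_interior _) => g _; exact: invg_continuous.
- by split; rewrite /preimage/= ?invg1; exact: V1.
- by move=> g [Vg Vg']; split => //; rewrite /preimage/= invgK.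
Qed.

Lemma square_nbhd V : nbhs (1%g : G) V ->
  exists2 W, symmetric_nbhd W & forall g h, W g -> W h -> V (g * h)%g.
Proof.
move=> V1.
have : nbhs ((1, 1)%g : G * G) (fun p => V (p.1 * p.2)%g).
  by apply: mulg_cvg; rewrite mulg1.
case=> -[A B] [/= A1 B1] AB.
have [W sW WAB] := symmetric_nbhd_sub (filterI A1 B1).
by exists W => // g h /WAB[Ag _] /WAB[_ Bh]; exact: (AB (g, h)).
Qed.

(** A finite intersection of preimages of [V] under conjugations; it allows a TT set to be moved by
    any of finitely many group elements. *)
Lemma conj_nbhd V F : finite_set F -> nbhs (1%g : G) V ->
  exists2 W, symmetric_nbhd W & forall f g, F f -> W g -> V (f^-1 * g * f)%g.
Proof.
move=> fF V1.
have : nbhs (1%g : G) (\bigcap_(f in F) [set g | V (f^-1 * g * f)%g]).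
  apply: filter_finite_bigcap => // f _.
  have : (fun g : G => (f^-1 * g * f)%g) @ (1%g : G) --> (f^-1 * 1 * f)%g.
    apply: (cvg_comp (fun g : G => (f^-1 * g)%g) (fun g => (g * f)%g)).
      exact: mulg_continuousr.
    exact: mulg_continuousl.
  by apply; rewrite mulg1 mulVg.
move=> /symmetric_nbhd_sub[W sW WF]; exists W => // f g Ff Wg; exact: (WF g Wg f Ff).
Qed.

End Groups.

Section Actions.
Context {G : topologicalGroupType} {X : gspace G}.
Implicit Types (U V W : set G) (F : set G) (A B : set X).

Lemma gactVK g : cancel (@gact G X g^-1%g) (gact g).
Proof. by move=> x; rewrite -gactM mulgV gact1. Qed.

Lemma setactP U A x : setact U A x <-> exists2 g, U g & A (gact g^-1%g x).
Proof.
split=> [[g Ug [a Aa <-]]|[g Ug Ax]]; first by exists g => //; rewrite gactK.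
by exists g => //; exists (gact g^-1%g x); rewrite ?gactVK.
Qed.

Lemma setactE U A : setact U A = \bigcup_(g in U) (gact g @` A).
Proof.
by rewrite eqEsubset; split=> x [g Ug [a Aa <-]]; exists g => //; exists a.
Qed.

Lemma setact_open U A : open A -> open (setact U A).
Proof. by move=> oA; rewrite setactE; apply: bigcup_open => g _; exact: gact_open. Qed.

Lemma setactM U V W A : (forall g h, U g -> V h -> W (g * h)%g) ->
  setact U (setact V A) `<=` setact W A.
Proof.
move=> UVW _ [g Ug [_ [h Vh [a Aa <-]] <-]].
by exists (g * h)%g; [exact: UVW|exists a; rewrite ?gactM].
Qed.

Lemma TT_sub U A B : TT U A -> open B -> B !=set0 -> B `<=` A -> TT U B.
Proof.
move=> [oA A0 UA] oB B0 BA; split=> // C oC C0 CB.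
by apply: (subset_trans BA); apply: UA => //; exact: subset_trans CB BA.
Qed.

Lemma TT_gact U V A g : TT V A -> (forall v, V v -> U (g^-1 * v * g)%g) ->
  TT U (gact g^-1%g @` A).
Proof.
move=> [oA [a Aa] VA] VU; split; first exact: gact_open.
  by exists (gact g^-1%g a); exists a.
move=> B oB [b Bb] BA _ [x Ax <-].
apply/closure_openP => C oC Cx.
have [||||_ [[v Vv [_ [c Bc <-] <-]]]] := VA (gact g @` B) _ _ _ x Ax (gact g @` C).
- exact: gact_open.
- by exists (gact g b); exists b.
- by move=> _ [c /BA[d Ad <-] <-]; rewrite gactVK.
- apply: open_nbhs_nbhs; split; first exact: gact_open.
  by exists (gact g^-1%g x); rewrite ?gactVK.
move=> [d Cd E]; exists d; split => //; exists (g^-1 * v * g)%g; first exact: VU.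
by exists c => //; rewrite !gactM -E gactK.
Qed.

(** What the translates of [B] leave uncovered in [K] is closed and invariant; were it nonempty, it
    would be a subflow missing [B]. Compactness then makes the cover finite. *)
Lemma subflow_cover (K B : set X) : compact K -> closed K ->
  (forall g x, K x -> K (gact g x)) -> open B ->
  (forall N : set X, subflow N -> N `<=` K -> N `&` B !=set0) ->
  exists2 F : set G, finite_set F & K `<=` setact F B.
Proof.
move=> cK clK iK oB HB.
have [||F fF KF] := @compact_finite_cover X K G (fun g => gact g @` B) cK.
- by move=> g; exact: gact_open.
- rewrite -setactE; apply: contrapT => nsub.
  have [||x [[Kx nx] Bx]] := HB (K `\` setact setT B).
  + split.
    * apply: contrapT => E0; apply: nsub => x Kx; apply: contrapT => nx.
      by apply: E0; exists x.
    * by apply: closedI => //; apply: open_closedC; exact: setact_open.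
    * move=> g x [Kx nx]; split; first exact: iK.
      move=> /setactP[h _ hx]; apply: nx; apply/setactP; exists (g^-1 * h)%g => //.
      by rewrite invgM invgK gactM.
  + by move=> x [].
  + by apply: nx; exists 1%g => //; exists x; rewrite ?gact1.
by exists F => //; rewrite setactE.
Qed.

Lemma minimal_cover A : gflow X -> minimal X -> open A -> A !=set0 ->
  exists2 F : set G, finite_set F & setact F A = setT.
Proof.
move=> cX [sX mX] oA A0.
have [|F fF AF] := subflow_cover cX (@closedT _) (fun _ _ _ => I) oA.
  by move=> N sN /(mX _ sN)->; rewrite setTI.
by exists F => //; rewrite eqEsubset; split.
Qed.

End Actions.

Section TT_and_thickness.
Context {G : topologicalGroupType} {X : gspace G}.
Implicit Types (U V W : set G) (F : set G) (A B : set X).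

(** The TT set [C] meets a translate [f A], and [f^-1] moves the common part back into [A]. [V] is
    chosen after the finite set [F] of possible [f], so that the conjugates stay in [U]. *)
Lemma somewhere_TT_rosendal : gflow X -> minimal X ->
  (forall U, symmetric_nbhd U -> somewhere_TT U [set: X]) -> rosendal_criterion X.
Proof.
move=> cX mX HTT U sU A oA A0.
have [F fF FA] := minimal_cover cX mX oA A0.
have [V sV VU] := conj_nbhd fF (symmetric_nbhd_nbhs sU).
have [C _ VC] := HTT V sV; have [oC [c Cc] _] := VC.
have : [set: X] c by [].
rewrite -FA => /setactP[f Ff Ac].
exists (gact f^-1%g @` (C `&` gact f @` A)).
  by move=> _ [_ [_ [a Aa <-]] <-]; rewrite gactK.
apply: TT_gact (VU f ^~ Ff); apply: TT_sub VC _ _ _.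
- by apply: openI => //; exact: gact_open.
- by exists c; split => //; exists (gact f^-1%g c); rewrite ?gactVK.
- by move=> x [].
Qed.

(** Every nonempty open [A] has a translate by some [f^-1] that meets the TT set [C], so the closure
    of [U F^-1 A] contains [C]; two such open sets must meet inside [C]. *)
Lemma somewhere_TT_thickness : gflow X -> minimal X ->
  (forall U, symmetric_nbhd U -> somewhere_TT U [set: X]) -> thickness_condition X.
Proof.
move=> cX mX HTT U sU; have [C _ [oC C0 UC]] := HTT U sU.
have [F fF FC] := minimal_cover cX mX oC C0.
exists [set f^-1%g | f in F]; first exact: finite_image.
have meet A : open A -> A !=set0 ->
    C `<=` closure (setact U (setact [set f^-1%g | f in F] A)).
  move=> oA [a Aa]; have : [set: X] a by [].
  rewrite -FC => /setactP[f Ff Ca].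
  apply: subset_trans (UC (C `&` (gact f^-1%g @` A)) _ _ _) _.
  - by apply: openI => //; exact: gact_open.
  - by exists (gact f^-1%g a); split => //; exists a.
  - by move=> x [].
  - apply: closureS; apply: setactS => // x [_ [b Ab <-]].
    by exists f^-1%g; [exists f|exists b].
move=> A B oA A0 oB B0; have [c Cc] := C0.
have := meet A oA A0 c Cc => /closure_openP/(_ _ oC Cc)[x [Ax Cx]].
have := meet B oB B0 x Cx.
move=> /closure_openP/(_ (setact U (setact [set f^-1%g | f in F] A))).
case=> [||y [yB yA]] //; last by exists y.
by apply: setact_open; exact: setact_open.
Qed.

(* A pair [(f, f')] with [W f A] meeting [W f' B] can be separated by shrinking *)
(* [A] and [B], since no open set is [W^4]-TT; finitely many steps then refute  *)
(* thickness.                                                                   *)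
Lemma thickness_somewhere_TT : [set: X] !=set0 -> thickness_condition X ->
  forall U, symmetric_nbhd U -> somewhere_TT U [set: X].
Proof.
move=> X0 HT U sU; apply: contrapT => nTT.
have [V sV VU] := square_nbhd (symmetric_nbhd_nbhs sU).
have [W sW WV] := square_nbhd (symmetric_nbhd_nbhs sV).
have split_open A : open A -> A !=set0 ->
    exists C D, [/\ open C /\ C !=set0, open D /\ D !=set0,
      C `<=` A, D `<=` A & setact U C `&` D = set0].
  move=> oA A0; apply: contrapT => nCD; apply: nTT; exists A => //; split=> //.
  move=> C oC C0 CA x Ax; apply/closure_openP => D oD Dx.
  apply: contrapT => CD0; apply: nCD; exists C, (D `&` A); split=> //.
  - by split; [exact: openI|exists x].
  - rewrite -subset0 => y [Cy [Dy _]]; apply: CD0; by exists y.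
have [F fF HF] := HT W sW.
have [s Fs] : exists s : seq (G * G), forall f f', F f -> F f' -> (f, f') \in s.
  have /finite_fsetP[E FE] := finite_setX fF fF.
  by exists (enum_fset E) => f f' Ff Ff'; have : [set` E] (f, f') by rewrite -FE.
have [A [B [[oA A0] [oB B0] AB]]] : exists A B, [/\ open A /\ A !=set0,
    open B /\ B !=set0 & forall p, p \in s ->
    setact W (gact p.1 @` A) `&` setact W (gact p.2 @` B) = set0].
  elim: s {Fs} => [|[f f'] s [A [B [[oA A0] [oB B0] IH]]]].
    by exists setT, setT; split => //; split => //; exact: openT.
  have shrink C D : C `<=` A -> D `<=` B -> forall p, p \in s ->
      setact W (gact p.1 @` C) `&` setact W (gact p.2 @` D) = set0.
    move=> CA DB p /IH; rewrite -!subset0; apply: subset_trans.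
    by apply: setISS; apply: setactS => //; exact: image_subset.
  have [E0|nE] := pselect (setact W (gact f @` A) `&` setact W (gact f' @` B) = set0).
    exists A, B; split => // p; rewrite inE => /orP[/eqP->//|]; exact: IH.
  have [x [/setactP[w Ww Ax] /setactP[w' Ww' Bx]]] :
      setact W (gact f @` A) `&` setact W (gact f' @` B) !=set0.
    by apply: contrapT => n0; apply: nE; rewrite -subset0 => y ?; apply: n0; exists y.
  (* The part of [f A] reached from [f' B] by [V]; it is nonempty because it contains [w^-1 x]. *)
  pose A' := gact f @` A `&` setact V (gact f' @` B).
  have oA' : open A' by apply: openI; [|apply: setact_open]; exact: gact_open.
  have [|C [D [[oC [c Cc]] [oD [d Dd]] CA DA CD]]] := split_open _ oA'.
    exists (gact w^-1%g x); split => //; apply/setactP; exists (w^-1 * w')%g.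
      by apply: WV => //; case: sW => _ _; apply.
    by rewrite invgM invgK gactM gactVK.
  have [_ [v Vv [_ [b Bb <-] E]]] := CA _ Cc.
  have v'f' z : gact (v * f')%g z = gact v (gact f' z) by rewrite gactM.
  (* Here [v] carries a point of [f' B] into [C]. If the shrunken translates still met, some [d1] in
     [D] would equal [w1^-1 w2 v^-1 c1] with [c1] in [C], hence lie in [U C]. *)
  exists (A `&` gact f^-1%g @` D), (B `&` gact (v * f')^-1%g @` C); split.
  - split; first by apply: openI => //; exact: gact_open.
    have [[a Aa fad] _] := DA _ Dd.
    by exists a; split => //; exists d => //; rewrite -fad gactK.
  - split; first by apply: openI => //; exact: gact_open.
    by exists b; split => //; exists c => //; rewrite -E -v'f' gactK.
  - move=> p; rewrite inE => /orP[/eqP-> /=|]; last by apply: shrink => y [].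
    rewrite -subset0 => y [].
    move=> [w1 Ww1 [_ [_ [_ [d1 Dd1 <-]] <-] <-]] [w2 Ww2 [_ [_ [_ [c1 Cc1 <-]] <-] E2]].
    suff : (setact U C `&` D) d1 by rewrite CD.
    split=> //; exists (w1^-1 * w2 * v^-1)%g.
      apply: VU; last by case: sV => _ _; apply.
      by apply: WV => //; case: sW => _ _; apply.
    exists c1 => //; move: E2; rewrite gactVK invgM gactM gactVK => E2.
    by rewrite !gactM E2 gactK.
have mF f C : F f -> gact f @` C `<=` setact F C.
  by move=> Ff _ [y Cy <-]; exists f => //; exists y.
have [x [[w Ww [_ [f Ff [a Aa <-]] Ex]] [w' Ww' [_ [f' Ff' [b Bb <-]] Ex']]]] :=
  HF A B oA A0 oB B0.
have /AB/= : (f, f') \in s by exact: Fs.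
rewrite -subset0 => /(_ x); apply; split.
  by exists w => //; exists (gact f a) => //; exists a.
by exists w' => //; exists (gact f' b) => //; exists b.
Qed.

End TT_and_thickness.

(** * Continuous semi-norms *)

Section Birkhoff_Kakutani.
Context {R : realType} {G : topologicalGroupType}.

Lemma half_expn_lt (e : R) : 0 < e -> exists n, 2^-1 ^+ n < e.
Proof.
move=> e0.
have hn n : 2^-1 ^+ n * n.+1%:R <= 1 :> R.
  elim: n => [|n IH]; first by rewrite expr0 mul1r.
  apply: le_trans IH; rewrite exprS -mulrA mulrCA ler_wpM2l ?exprn_ge0 ?invr_ge0//.
  by rewrite ler_pdivrMl// -natrM ler_nat mul2n -addnn addSn addnS !ltnS leq_addr.
have [n en] : exists n, e^-1 < n.+1%:R.
  by exists (Num.truncn e^-1); exact: truncnS_gt.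
exists n; rewrite -(ltr_pM2r (ltr0Sn R n)); apply: le_lt_trans (hn n) _.
by rewrite -ltr_pdivrMl ?mulr1.
Qed.

Variable U : nat -> set G.
Hypothesis U_symm : forall n, symmetric_nbhd (U n).
Hypothesis U3 : forall n g h k, U n.+1 g -> U n.+1 h -> U n.+1 k -> U n (g * (h * k))%g.

Implicit Types (l : seq (nat * G)) (n : nat) (g h : G).

(** A list of pairs [(n, g)] is a word, admissible when each [g] lies in its [U n]. The semi-norm of
    a group element is the infimum of the weights of the admissible words that multiply to it,
    capped at 1. *)
Let wt l : R := \sum_(p <- l) 2^-1 ^+ p.1.
Let pr l : G := (\prod_(p <- l) p.2)%g.
Let adm l := forall p, p \in l -> U p.1 p.2.

Let wt_ge0 l : 0 <= wt l.
Proof. by apply: sumr_ge0 => p _; rewrite exprn_ge0// invr_ge0. Qed.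

Let U1 n : U n 1%g. Proof. by have [] := U_symm n. Qed.

Let UV n g : U n g -> U n g^-1%g. Proof. by have [_ _] := U_symm n; exact. Qed.

Let U_dec m n : (m <= n)%N -> U n `<=` U m.
Proof.
elim: n => [|n IH]; first by rewrite leqn0 => /eqP->.
rewrite leq_eqVlt => /orP[/eqP->//|/IH]; apply: subset_trans => g Ug.
by rewrite -(mulg1 g) -(mulg1 1%g); exact: U3.
Qed.

(** The cut is at the first letter whose tail weighs less than [d]; as no earlier letter qualifies,
    the part before it weighs less than [c]. *)
Let split_weight l (c d : R) : 0 < d -> l != [::] -> wt l < c + d -> 0 < c ->
  exists l1 p l2, [/\ l = l1 ++ p :: l2, wt l1 < c & wt l2 < d].
Proof.
elim: l c => // p l IH c d0 _; rewrite /wt big_cons -/(wt l) => pl c0.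
have [ld|dl] := ltP (wt l) d; first by exists [::], p, l; rewrite /wt big_nil.
have l0 : l != [::].
  by apply/eqP => l0; move: dl; rewrite l0 /wt big_nil leNgt d0.
have [||l1 [q [l2 [-> l1c l2d]]]] := IH (c - 2^-1 ^+ p.1) d0 l0; try lra.
exists (p :: l1), q, l2; split => //; rewrite /wt big_cons -/(wt l1); lra.
Qed.

(* Split a product of weight [< 2^-n] into two parts of weight [< 2^-(n+1)]   *)
(* around one factor, which then lies in [U n.+1].                             *)
Let chain l n : adm l -> wt l < 2^-1 ^+ n -> U n (pr l).
Proof.
elim: {l}(size l) {-2}l (leqnn (size l)) n => [|k IH] l.
  by rewrite leqn0 size_eq0 => /eqP-> n _ _; rewrite /pr big_nil.
move=> lk n al; have [->|l0] := eqVneq l [::].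
  by rewrite /pr big_nil.
have h0 : 0 < 2^-1 ^+ n.+1 :> R by rewrite exprn_gt0// invr_gt0.
have hS : 2^-1 ^+ n = 2^-1 ^+ n.+1 + 2^-1 ^+ n.+1 :> R.
  by rewrite exprS; lra.
rewrite hS => wl; have [l1 [p [l2 [E l1c l2d]]]] := split_weight h0 l0 wl h0.
move: lk; rewrite E size_cat/= addnS ltnS -E => lk.
rewrite E /pr big_cat big_cons/=; apply: U3.
- apply: IH => //; first exact: leq_trans (leq_addr _ _) lk.
  by move=> q q1; apply: al; rewrite E mem_cat q1.
- apply: (@U_dec _ p.1); last by apply: al; rewrite E mem_cat inE eqxx orbT.
  have : 2^-1 ^+ p.1 < 2^-1 ^+ n :> R.
    rewrite hS; apply: le_lt_trans wl.
    rewrite E /wt big_cat big_cons/= addrCA lerDl addr_ge0//; exact: wt_ge0.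
  by rewrite ltr_iXn2l// ?invr_gt0// invf_lt1// ltr1n.
- apply: IH => //; first exact: leq_trans (leq_addl _ _) lk.
  by move=> q q1; apply: al; rewrite E mem_cat inE q1 !orbT.
Qed.

(** The value 1 makes the set nonempty for every [g] and the semi-norm bounded. *)
Let weights g : set R :=
  [set r | r = 1 \/ exists l, [/\ adm l, pr l = g & r = wt l]].

Let weights_ge0 g r : weights g r -> 0 <= r.
Proof. by move=> [->//|[l [_ _ ->]]]. Qed.

Let weights1 g : weights g 1. Proof. by left. Qed.

Let lbound_weights g : has_lbound (weights g).
Proof. by exists 0 => r /weights_ge0. Qed.

Let s g := inf (weights g).

Let s_le g r : weights g r -> s g <= r.
Proof. by move=> gr; exact: ge_inf. Qed.

Let s_ge0 g : 0 <= s g.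
Proof. by apply: lb_le_inf; [exists 1|exact: weights_ge0]. Qed.

Let s_small n g : U n g -> s g <= 2^-1 ^+ n.
Proof.
move=> Ug; apply: s_le; right; exists [:: (n, g)]; split.
- by move=> p; rewrite inE => /eqP->.
- by rewrite /pr big_seq1.
- by rewrite /wt big_seq1.
Qed.

Let sM g h : s (g * h)%g <= s g + s h.
Proof.
rewrite -lerBlDl; apply: lb_le_inf; first by exists 1.
move=> b hb; rewrite lerBlDl -lerBlDr; apply: lb_le_inf; first by exists 1.
move=> a ga; rewrite lerBlDr.
case: ga => [->|[l [al <- ->]]].
  by apply: (@le_trans _ _ 1); [exact: s_le|rewrite lerDl (weights_ge0 hb)].
case: hb => [->|[l' [al' <- ->]]].
  by apply: (@le_trans _ _ 1); [exact: s_le|rewrite lerDr].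
apply: s_le; right; exists (l ++ l'); split.
- by move=> p; rewrite mem_cat => /orP[/al|/al'].
- by rewrite /pr big_cat.
- by rewrite /wt big_cat.
Qed.

(** Reversing a word and inverting its letters preserves admissibility and weight. *)
Let sV g : s g^-1%g = s g.
Proof.
suff le h : s h^-1%g <= s h by apply/eqP; rewrite eq_le le -{1}(invgK g) le.
apply: lb_le_inf; first by exists 1.
move=> _ [->|[l [al <- ->]]]; first exact: s_le.
apply: s_le; right; exists (rev [seq (p.1, p.2^-1%g) | p <- l]); split.
- by move=> p; rewrite mem_rev => /mapP[q ql ->]/=; apply: UV; exact: al.
- elim: l {al} => [|p l IH]; first by rewrite /pr !big_nil invg1.
  by rewrite /pr map_cons rev_cons -cats1 big_cat big_seq1 big_cons invgM -IH.
- by rewrite /wt (perm_big _ (permEl (perm_rev _))) big_map.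
Qed.

Let s_continuous : continuous s.
Proof.
move=> g; apply/cvgrPdist_le => e /half_expn_lt[n ne].
have gU : nbhs g [set h | U n (g^-1 * h)%g].
  apply: (@mulg_continuousr G g^-1%g g); rewrite mulVg.
  exact: symmetric_nbhd_nbhs.
apply: filterS gU => h /s_small gh; rewrite ler_distl; apply/andP; split.
- rewrite lerBlDl; have := sM g (g^-1 * h)%g; rewrite mulgA mulgV mul1g; lra.
- have := sM h (g^-1 * h)^-1%g; rewrite invgM invgK mulgA mulgV mul1g.
  have := sV (g^-1 * h)%g; rewrite invgM invgK => ->; lra.
Qed.

(** A value below 1 comes from a word of weight below [2^-0], and such a word multiplies into
    [U 0]. *)
Lemma seminorm_of_chain : exists2 s : G -> R, SN s & sball s 1 `<=` U 0.
Proof.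
exists s; last first.
  move=> g; rewrite /sball/= => sg.
  have [|r] := inf_lt _ sg; first by exists 1.
  by move=> [->|[l [al <- ->]]]; [rewrite ltxx|move=> l1; apply: chain].
split => //; first by split => //; exists 1 => g; exact: s_le.
apply/eqP; rewrite eq_le s_ge0 andbT; apply: s_le; right; exists [::].
by rewrite /pr /wt !big_nil.
Qed.

End Birkhoff_Kakutani.

(** Two applications of [square_nbhd] give a neighbourhood whose threefold products stay in the
    previous one; iteration supplies the sequence required above. *)
Lemma seminorm_in_nbhd (R : realType) (G : topologicalGroupType) (V : set G) :
  nbhs (1%g : G) V -> exists2 s : G -> R, SN s & sball s 1 `<=` V.
Proof.
have step (W : set G) : nbhs (1%g : G) W -> exists W' : set G, symmetric_nbhd W' /\
    forall g h k, W' g -> W' h -> W' k -> W (g * (h * k))%g.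
  move=> /square_nbhd[W1 sW1 W1W].
  have [W2 sW2 W2W] := square_nbhd (symmetric_nbhd_nbhs sW1).
  exists W2; split => // g h k Wg Wh Wk; apply: W1W; last exact: W2W.
  by rewrite -(mulg1 g); apply: W2W => //; case: sW2.
move=> V1; have [W0 sW0 W0V] := symmetric_nbhd_sub V1.
pose next (W : set G) : set G :=
  if pselect (nbhs (1%g : G) W) is left H then projT1 (cid (step W H)) else W.
have nextP W : symmetric_nbhd W -> symmetric_nbhd (next W) /\
    forall g h k, next W g -> next W h -> next W k -> W (g * (h * k))%g.
  by move=> /symmetric_nbhd_nbhs sW; rewrite /next; case: pselect => // H; case: (cid _).
have sU n : symmetric_nbhd (iter n next W0) by elim: n => //= n /nextP[].
have [s sSN sU0] := @seminorm_of_chain R G (fun n => iter n next W0) sU (fun n => (nextP _ (sU n)).2).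
by exists s => //; exact: subset_trans sU0 W0V.
Qed.

Lemma seminorm_base_SN (R : realType) (G : topologicalGroupType) :
  seminorm_base (@SN R G).
Proof.
split=> // [s c sSN c0|V /(@seminorm_in_nbhd R)[s sSN sV]]; first exact: (nbhs_sball sSN c0).
by exists s, 1.
Qed.

(** * Compatible points *)

Section Pseudometric.
Context {R : realType} {G : topologicalGroupType} {X : gspace G}.
Implicit Types (s : G -> R) (c d e : R) (x y z : X) (A B : set X).

Lemma dsn_ltP s c x y : (dsn s x y < c%:E)%E <->
  exists d, [/\ 0 <= d, d < c & dsn_le s d x y].
Proof.
split=> [/ereal_inf_lt[_ [d [d0 dxy] <-]]|[d [d0 dc dxy]]].
  by rewrite lte_fin => dc; exists d.
by apply: (@le_lt_trans _ _ d%:E); [apply/dsnP|rewrite lte_fin].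
Qed.

Lemma dsn_le_gact s g x : SN s -> dsn_le s (s g) x (gact g x).
Proof.
move=> sSN e e0 A oA Ax; apply: subset_closure; exists g; last by exists x.
by rewrite /sball/= ltrDl.
Qed.

Lemma closed_dsn_le s c x : closed [set y | dsn_le s c x y].
Proof.
move=> y cy e e0 A oA Ax; rewrite -closureK => B By.
by have [z [/(_ e e0 A oA Ax) cz Bz]] := cy B By; exists z.
Qed.

Lemma symmetric_nbhd_sball s c : SN s -> 0 < c -> symmetric_nbhd (sball s c).
Proof.
move=> [cs _ s1 sV _] c0; split.
- by rewrite (_ : sball s c = s @^-1` [set t | t < c])//; apply: open_comp => // g _; exact: cs.
- by rewrite /sball/= s1.
- by move=> g; rewrite /sball/= sV.
Qed.

Lemma setact_sballD s c d A : SN s ->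
  setact (sball s c) (setact (sball s d) A) `<=` setact (sball s (c + d)) A.
Proof.
move=> [_ _ _ _ sD]; apply: setactM => g h; rewrite /sball/= => gc hd.
by apply: le_lt_trans (sD g h) _; exact: ltrD.
Qed.

(** The bridge from the pseudometric to the TT property: [dsn_le] with slack [e = d - c] says that
    [B_s(d) B] accumulates at every point of [A]. *)
Lemma dsn_TT s c d U A : c < d -> sball s d `<=` U -> open A -> A !=set0 ->
  (forall y z, A y -> A z -> dsn_le s c y z) -> TT U A.
Proof.
move=> cd sU oA A0 Ac; split=> // B oB [b Bb] BA x Ax.
have e0 : 0 < d - c by rewrite subr_gt0.
have := Ac b x (BA _ Bb) Ax _ e0 B oB Bb; rewrite addrC subrK.
by apply: closureS; exact: setactS.
Qed.

Hypothesis X_GED : GED X.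

Lemma compatible_TT s d U x : SN s -> 0 < d -> sball s d `<=` U ->
  compatible (dsn s) x ->
  exists2 c, 0 < c & TT U [set z | (dsn s x z < c%:E)%E]°.
Proof.
move=> sSN d0 sU cx; exists (d / 3%:R); first by lra.
have xc : [set z | (dsn s x z < (d / 3%:R)%:E)%E]° x by apply: cx; lra.
apply: (@dsn_TT s (2%:R * (d / 3%:R)) d) => //; first by lra.
- exact: open_interior.
- by exists x.
- move=> y z /interior_subset/dsn_ltP[c [_ /ltW cd xy]].
  move=> /interior_subset/dsn_ltP[c' [_ /ltW cd' xz]].
  apply: (@dsn_le_weak _ _ _ _ (c + c')); first by lra.
  by apply: (dsn_le_trans sSN X_GED _ xz); exact: dsn_le_sym.
Qed.

Lemma base_compatible_somewhere_TT (Bs : set (G -> R)) : seminorm_base Bs ->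
  (forall s, Bs s -> compatible (@dsn R G X s) !=set0) ->
  forall U, symmetric_nbhd U -> somewhere_TT U [set: X].
Proof.
move=> [BSN _ Bbase] H U sU.
have [s [c [Bss c0 scU]]] := Bbase U (symmetric_nbhd_nbhs sU).
have [x cx] := H s Bss.
have [d _ Ud] := compatible_TT (BSN _ Bss) c0 scU cx.
by exists [set z | (dsn s x z < d%:E)%E]°.
Qed.

(** By the criterion, the TT sets for the ball of radius [2^-n] have a dense open union. A point of
    all these unions is compatible, since every point of a TT set around it is within [2^-n] of
    it. *)
Lemma rosendal_dense_compatible : gflow X -> rosendal_criterion X ->
  forall s : G -> R, SN s -> dense (compatible (@dsn R G X s)).
Proof.
move=> cX RC s sSN.
have h0 n : 0 < 2^-1 ^+ n :> R by rewrite exprn_gt0// invr_gt0.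
pose O n := \bigcup_(A in @TT G X (sball s (2^-1 ^+ n))) A.
have : dense (\bigcap_n O n).
  apply: compact_hausdorff_baire => //; first exact: gspace_hausdorff.
    by move=> n; apply: bigcup_open => A [].
  move=> n A A0 oA.
  have [B BA UB] := RC _ (symmetric_nbhd_sball sSN (h0 n)) A oA A0.
  by have [_ [b Bb] _] := UB; exists b; split; [exact: BA|exists B].
move=> dO A A0 oA; have [x [Ax Ox]] := dO A A0 oA; exists x; split => // c c0.
have [n nc] := half_expn_lt c0.
have [B [oB B0 UB] Bx] := Ox n I.
rewrite /interior; apply: filterS (open_nbhs_nbhs (conj oB Bx)) => y By.
apply/dsn_ltP; exists (2^-1 ^+ n); split; [exact: ltW|exact: nc|].
move=> e e0 C oC Cx.
have := UB (C `&` B) (openI oC oB) (ex_intro _ x (conj Cx Bx)) (@subIsetr _ _ _) y By.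
apply: closureS; apply: setactS; last exact: subIsetl.
by move=> g; rewrite /sball/=; lra.
Qed.

Section Quotient.
Local Open Scope quotient_scope.
Variables (s : G -> R) (s_SN : SN s).

Lemma dsn_class_continuous : continuous (dsn_class s_SN X_GED).
Proof. exact: pi_continuous. Qed.

Lemma dsn_class_surj q : exists x, dsn_class s_SN X_GED x = q.
Proof. by exists (repr (q : {eq_quot dsn_equiv s_SN X_GED})); exact: reprK. Qed.

Lemma dsn_classP x y : dsn_class s_SN X_GED x = dsn_class s_SN X_GED y <-> dsn_le s 0 x y.
Proof.
rewrite -dsn0P; split=> [/(@eqmodP _ (dsn_equiv s_SN X_GED))/asboolP//|xy].
by apply/(@eqmodP _ (dsn_equiv s_SN X_GED)); exact/asboolP.
Qed.

Lemma open_dsn_class A : open A -> (forall x y, A x -> dsn_le s 0 x y -> A y) ->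
  open (dsn_class s_SN X_GED @` A).
Proof.
move=> oA sA; rewrite (_ : open _ = open (dsn_class s_SN X_GED @^-1`
  (dsn_class s_SN X_GED @` A)))//.
rewrite (_ : _ @^-1` _ = A)// eqEsubset; split=> [x [y Ay /dsn_classP]|x Ax].
  exact: sA.
by exists x.
Qed.

(** Half of [e] puts [y] in a closure, and [G]-ED turns this into an interior at the cost of the
    other half. *)
Lemma dsn_le0_interior A e x y : open A -> A x -> 0 < e -> dsn_le s 0 x y ->
  (closure (setact (sball s e) A))° y.
Proof.
move=> oA Ax e0 xy; have e20 : 0 < e / 2 by lra.
have := xy (e / 2) e20 A oA Ax; rewrite add0r => Ay.
have /(_ y Ay) := X_GED (setact_open (sball s (e / 2)) oA) (nbhs_sball s_SN e20).
apply: interiorS; apply: closureS.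
by have := @setact_sballD s (e / 2) (e / 2) A s_SN; rewrite -splitr.
Qed.

(** The interiors of the balls of radius below [c] have a saturated union, because moving at
    distance 0 costs only a slight increase of the radius. The image of this union is thus open in
    the quotient. *)
Lemma compatible_quotient x : compatible (dsn s) x ->
  compatible (dsn_bar s_SN X_GED) (dsn_class s_SN X_GED x).
Proof.
move=> cx c c0.
pose O := \bigcup_(d in [set d | d < c]) [set z | (dsn s x z < d%:E)%E]°.
have oO : open O by apply: bigcup_open => d _; exact: open_interior.
have sO y z : O y -> dsn_le s 0 y z -> O z.
  (* One [e] is spent on the translates by [B_s(e)] and one on making the bound strict; [d + 2 e] is
     still below [c]. *)
  move=> [d dc yd] yz; pose e := (c - d) / 3%:R.
  exists (d + 2%:R * e); first by rewrite /e/=; move: dc; rewrite /=; lra.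
  have e0 : 0 < e by rewrite /e; move: dc; rewrite /=; lra.
  have := dsn_le0_interior (@open_interior _ _) yd e0 yz; apply: interiorS.
  apply: (@subset_trans _ [set t | dsn_le s (d + e) x t]).
    rewrite [X in _ `<=` X](closure_id _).1; last exact: closed_dsn_le.
    apply: closureS => _ [g sg [t /interior_subset/dsn_ltP[b [_ bd xt]] <-]].
    apply: (@dsn_le_weak _ _ _ s (b + s g)); last exact: (dsn_le_trans s_SN X_GED xt (@dsn_le_gact s g t s_SN)).
    by move: sg; rewrite /sball/= => sg; lra.
  move=> t xt; apply/dsn_ltP; exists (d + e); split => //; last by lra.
  have /dsn_ltP[b [b0 bd _]] := interior_subset yd; lra.
have Ox : O x by exists (c / 2); [rewrite /=; lra|apply: cx; lra].
apply: (@filterS _ _ _ (dsn_class s_SN X_GED @` O)).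
  move=> _ [z [d /= dc /interior_subset xz] <-]; rewrite /= dsn_barE.
  by apply: lt_trans xz _; rewrite lte_fin.
by apply: open_nbhs_nbhs; split; [exact: open_dsn_class|exists x].
Qed.

Lemma compatible_of_quotient x : compatible (dsn_bar s_SN X_GED) (dsn_class s_SN X_GED x) ->
  compatible (dsn s) x.
Proof.
move=> cx c c0; have := @dsn_class_continuous x _ (cx c c0).
suff -> : [set z | (dsn s x z < c%:E)%E] = dsn_class s_SN X_GED @^-1`
  [set q | (dsn_bar s_SN X_GED (dsn_class s_SN X_GED x) q < c%:E)%E] by [].
by apply/seteqP; split=> z; rewrite /preimage/= dsn_barE.
Qed.

End Quotient.

Lemma dense_compatible_quotient s (s_SN : SN s) : dense (compatible (@dsn R G X s)) ->
  dense (compatible (dsn_bar s_SN X_GED)).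
Proof.
move=> H O [q Oq] oO; have [x xq] := dsn_class_surj q.
have [||y [Oy cy]] := H (dsn_class s_SN X_GED @^-1` O).
- by exists x; rewrite /preimage/= xq.
- by apply: open_comp => // y _; exact: dsn_class_continuous.
- by exists (dsn_class s_SN X_GED y); split => //; exact: compatible_quotient.
Qed.

(* Density in the quotient only gives compatible points in saturated open sets; *)
(* the union of the [Int cl(B_s(c) A)] for [c < 1/10] is saturated.             *)
Lemma dense_compatible_quotient_rosendal :
  (forall s (s_SN : SN s), dense (compatible (dsn_bar s_SN X_GED))) ->
  rosendal_criterion X.
Proof.
move=> H U sU A oA [a Aa].
have [s sSN sU1] := seminorm_in_nbhd R (symmetric_nbhd_nbhs sU).
pose E c := (closure (setact (sball s c) A))°.
pose O := \bigcup_(c in [set c | 0 < c < 10%:R^-1]) E c.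
have oO : open O by apply: bigcup_open => c _; exact: open_interior.
have sO y z : O y -> dsn_le s 0 y z -> O z.
  move=> [c /andP[c0 c1] yc] yz; pose e := (10%:R^-1 - c) / 2.
  have e0 : 0 < e by rewrite /e; lra.
  exists (e + c); first by rewrite /= /e; apply/andP; split; lra.
  have := dsn_le0_interior sSN (@open_interior _ _) yc e0 yz; apply: interiorS.
  rewrite -[X in _ `<=` X]closureK; apply: closureS.
  apply: subset_trans (setactS (@subset_refl _ _) (@interior_subset _ _)) _.
  apply: (subset_trans (@setact_closure _ _ _ _)); apply: closureS.
  exact: setact_sballD.
have Oa : O a.
  exists (20%:R^-1); first by rewrite /=; apply/andP; split; lra.
  apply: filterS (@subset_closure _ _) _; apply: open_nbhs_nbhs.
  split; first exact: setact_open.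
  by exists 1%g; [rewrite /sball/=; case: sSN => _ _ -> _ _; lra|exists a; rewrite ?gact1].
have [||q [[x [c /andP[c0 c1] /interior_subset xE] <-] /compatible_of_quotient cx]] :=
    H s sSN (dsn_class sSN X_GED @` O).
- by exists (dsn_class sSN X_GED a); exists a.
- exact: open_dsn_class.
pose W := [set z | (dsn s x z < (10%:R^-1)%:E)%E]°.
have oW : open W by exact: open_interior.
have Wx : W x by apply: cx; lra.
have [_ [[g sg [b Ab <-]] Wgb]] := (closure_openP _ _).1 xE W oW Wx.
(* Every point of this set is within [1/10 + 1/10] of [x]: one term for [W], one for [g]. Its
   diameter is therefore at most [2/5], below 1. *)
exists (A `&` (gact g @^-1` W)); first by move=> ? [].
have d1 : 2%:R / 5%:R < 1 :> R by lra.
apply: (dsn_TT d1 sU1).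
- by apply: openI => //; apply: open_comp => // y _; exact: gact_continuousr.
- by exists b.
- have gW y : W (gact g y) -> dsn_le s (5%:R^-1) x y.
    move=> /interior_subset/dsn_ltP[d [d0 dl xd]].
    have := dsn_le_trans sSN X_GED xd (@dsn_le_gact s g^-1%g _ sSN).
    rewrite gactK; apply: dsn_le_weak.
    by have [_ _ _ -> _] := sSN; move: sg; rewrite /sball/=; lra.
  move=> y z [_ /gW xy] [_ /gW xz].
  have := dsn_le_trans sSN X_GED (dsn_le_sym sSN xy) xz.
  by apply: dsn_le_weak; lra.
Qed.

End Pseudometric.

(** * The universal equivariant compactification *)

Lemma continuous_ptws (I : eqType) (T V : topologicalType) (k : T -> {ptws I -> V}) :
  (forall i, continuous (fun x => k x i)) -> continuous k.
Proof.
move=> ck x; apply/cvg_sup => i A [_ [[C oC <-] Cp] CA].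
by apply: (filterS CA); apply: (ck i x C); exact: open_nbhs_nbhs.
Qed.

Section Separation_by_functions.
Context {R : realType}.

Lemma compact_urysohn (T : topologicalType) (A O : set T) :
  compact [set: T] -> hausdorff_space T -> closed A -> open O -> A `<=` O ->
  exists f : T -> R, [/\ continuous f, forall y, 0 <= f y <= 1,
    forall y, A y -> f y = 0 & forall y, ~ O y -> f y = 1].
Proof.
move=> cT hT cA oO AO.
have [f [cf f01 fA fO]] : exists f : T -> R, [/\ continuous f, range f `<=` `[0, 1],
    f @` A `<=` [set 0] & f @` (~` O) `<=` [set 1]].
  apply/uniform_separatorP.
  apply: (@normal_separatorP R T).1 (compact_normal hT cT) _ _ cA _ _.
    exact: open_closedC.
  by apply/disjoints_subset; rewrite setCK.
exists f; split => //.
- by move=> y; have := f01 (f y) (ex_intro2 _ _ y I erefl); rewrite /= in_itv.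
- by move=> y Ay; apply: fA; exists y.
- by move=> y nOy; apply: fO; exists y.
Qed.

Lemma compact_urysohn1 (T : topologicalType) (x : T) (O : set T) :
  compact [set: T] -> hausdorff_space T -> open O -> O x ->
  exists f : T -> R, [/\ continuous f, forall y, 0 <= f y <= 1, f x = 0 &
    forall y, ~ O y -> f y = 1].
Proof.
move=> cT hT oO Ox.
have [|f [cf f01 fx fO]] := compact_urysohn cT hT (@hausdorff_closed1 _ x hT) oO.
  by move=> _ ->.
by exists f; split => //; exact: fx.
Qed.

Lemma continuous_distr (T : topologicalType) (f h : T -> R) :
  continuous f -> continuous h -> continuous (fun x => `|f x - h x|).
Proof. by move=> cf ch x; apply: cvg_norm; apply: cvgB; [exact: cf|exact: ch]. Qed.

Lemma hausdorff_of_functions (T : topologicalType) (J : Type) (f : J -> T -> R) :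
  (forall j, continuous (f j)) -> (forall x y, (forall j, f j x = f j y) -> x = y) ->
  hausdorff_space T.
Proof.
move=> cf sf x y cl; apply: sf => j; apply: Rhausdorff => A B Ax By.
have [||z [Az Bz]] := cl (f j @^-1` A) (f j @^-1` B); [exact: cf|exact: cf|].
by exists (f j z).
Qed.

End Separation_by_functions.

Section Compactification.
Context {R : realType} {G : topologicalGroupType}.

(* These functions are the coordinates of S_G(Z); the uniformity in [u] makes the *)
(* action on the closure jointly continuous.                                      *)
Definition ruc (Z : gspace G) : set (Z -> R) :=
  [set f : Z -> R | [/\ continuous f, forall z, 0 <= f z <= 1 &
     forall e, 0 < e -> nbhs (1%g : G) [set u | forall z, `|f (gact u z) - f z| <= e]]].

Lemma ruc_gact (Z : gspace G) g (f : Z -> R) : ruc f -> ruc (f \o gact g).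
Proof.
move=> [cf f01 uf]; split => [z|z|e e0] //=.
  by apply: continuous_comp; [exact: gact_continuousr|exact: cf].
have [W sW WU] := conj_nbhd (finite_set1 g^-1%g) (uf e e0).
apply: filterS (symmetric_nbhd_nbhs sW) => u Wu z /=.
have := WU _ u erefl Wu (gact g z); rewrite invgK.
by rewrite -!gactM -!mulgA mulVg mulg1.
Qed.

(** The difference is small near each [(y, 1)], and compactness of [Y] provides one neighbourhood of
    the identity for all [y]. *)
Lemma ruc_flow (Y : gspace G) (f : Y -> R) : gflow Y -> continuous f ->
  (forall y, 0 <= f y <= 1) -> ruc f.
Proof.
move=> /compact_near_coveringP cY cf f01; split=> // e e0.
suff : \forall u \near (1%g : G), [set: Y] `<=` (fun y => `|f (gact u y) - f y| <= e).
  by apply: filterS => u uY z; exact: uY.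
apply: cY => y _.
have c1 : (fun p : Y * G => f (gact p.2 p.1)) @ (y, 1%g : G) --> f (gact 1%g y).
  apply: (cvg_comp (fun p : Y * G => gact p.2 p.1) f); last exact: cf.
  have : (fun p : Y * G => (p.2, p.1)) @ (y, 1%g : G) --> ((1%g : G), y).
    by apply: cvg_pair; [exact: cvg_snd|exact: cvg_fst].
  move=> h; exact: (cvg_comp _ (fun q : G * Y => gact q.1 q.2) h (@gact_continuous G Y (1%g, y))).
have c2 : (fun p : Y * G => f p.1) @ (y, 1%g : G) --> f y.
  by apply: (cvg_comp fst f); [exact: cvg_fst|exact: cf].
rewrite gact1 in c1.
have /cvgrPdist_le/(_ e e0) : (fun p : Y * G => f (gact p.2 p.1) - f p.1) @ (y, 1%g : G)
  --> f y - f y by exact: cvgB.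
by apply: filterS => -[y' u] /=; rewrite subrr sub0r normrN.
Qed.

Lemma ruc_comp (Z Y : gspace G) (h : Z -> Y) (f : Y -> R) : gmap h -> ruc f -> ruc (f \o h).
Proof.
move=> [ch eh] [cf f01 uf]; split=> [z|z|e e0] //=.
  by apply: continuous_comp; [exact: ch|exact: cf].
by apply: filterS (uf e e0) => u fu z /=; rewrite eh; exact: fu.
Qed.

Section Construction.
Variable Z : gspace G.
Local Notation T := (set_type (@ruc Z)).

Let ev (z : Z) : {ptws T -> R} := fun f => set_val f z.
Let D : set {ptws T -> R} := closure (range ev).
Local Notation S := (set_type D).

Definition coord (f : T) (p : S) : R := set_val p f.

Let ptws_coord (f : T) : continuous (fun p : {ptws T -> R} => p f).
Proof. exact: (@proj_continuous T (fun=> R) f). Qed.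

Lemma coord_continuous f : continuous (coord f).
Proof.
move=> p; apply: (@continuous_comp S {ptws T -> R} R set_val (fun p => p f)).
  exact: (@initial_continuous S _ set_val).
exact: ptws_coord.
Qed.

Lemma continuous_to_compactification (Y : topologicalType) (k : Y -> S) :
  (forall f, continuous (coord f \o k)) -> continuous k.
Proof.
by move=> ck; apply: (@continuous_comp_initial S Y _ set_val); exact: continuous_ptws.
Qed.

Lemma coord_inj p q : (forall f, coord f p = coord f q) -> p = q.
Proof. by move=> pq; apply: val_inj; apply: funext => f; exact: pq. Qed.

Definition compactify (z : Z) : S := SigSub (mem_set (subset_closure (ex_intro2 _ _ z I erefl : range ev (ev z)))).

Lemma compactify_continuous : continuous compactify.
Proof.
apply: continuous_to_compactification => f z.
by have [cf _ _] : ruc (set_val f) := set_valP f; exact: cf.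
Qed.

Lemma compactify_dense : dense (range compactify).
Proof.
move=> O [p Op] [B oB BO]; have Dp : D (set_val p) := set_valP p.
have [|_ [[z _ <-] Bz]] := Dp B.
  by apply: open_nbhs_nbhs; split => //; move: Op; rewrite -BO.
by exists (compactify z); split; [rewrite -BO|exists z].
Qed.

Lemma compactification_le (f : S -> R) c : continuous f ->
  (forall z, f (compactify z) <= c) -> forall p, f p <= c.
Proof.
move=> cf fc p; rewrite leNgt; apply/negP => fp.
have [||q [/= qf [z _ E]]] := @compactify_dense (f @^-1` [set t | c < t]).
- by exists p.
- by apply: open_comp => // q _; exact: cf.
- by move: qf; rewrite -E /preimage/= ltNge fc.
Qed.

(** Uniform bounds pass from the dense image to [S]; joint continuity of the action depends on
    this. *)
Lemma coord_lip (f h : T) e p : (forall z, `|set_val f z - set_val h z| <= e) ->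
  `|coord f p - coord h p| <= e.
Proof.
move=> fh; apply: (@compactification_le (fun p => `|coord f p - coord h p|)) => //.
by apply: continuous_distr; exact: coord_continuous.
Qed.

Lemma compactification_hausdorff : hausdorff_space S.
Proof. exact: (hausdorff_of_functions coord_continuous coord_inj). Qed.

Lemma compactification_compact : compact [set: S].
Proof.
have cube : compact [set p : {ptws T -> R} | forall t, `[0, 1]%classic (p t)].
  by apply: (@tychonoff T (fun=> R) (fun=> `[0, 1]%classic)) => _; exact: segment_compact.
have cD : compact D.
  apply: (subclosed_compact _ cube); first exact: closed_closure.
  move=> p Dp t; have cl : closed [set q : {ptws T -> R} | `[0, 1]%classic (q t)].
      by apply: (@closed_comp _ _ (fun q : {ptws T -> R} => q t)); [move=> q _; exact: ptws_coord|exact: itv_closed].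
  move: p Dp; rewrite -[forall p, _]/(D `<=` [set q : {ptws T -> R} | `[0, 1]%classic (q t)]).
  rewrite [X in _ `<=` X](closure_id _).1//; apply: closureS => _ [z _ <-].
  by have [_ f01 _] : ruc (set_val t) := set_valP t; rewrite /= in_itv; exact: f01.
move=> F PF _.
have FD : F (set_val @^-1` D) by apply: filterE => p; exact: set_valP.
have [p [Dp Fp]] := cD (set_val @ F) _ FD.
exists (SigSub (mem_set Dp)); split => // A B FA [_ [[C oC <-] Cp] CB].
have FA' : F (set_val @^-1` (set_val @` A)) by apply: filterS FA => q Aq; exists q.
have [|_ [[q Aq <-] Cq]] := Fp _ C FA'; first exact: open_nbhs_nbhs.
by exists q; split => //; exact: CB.
Qed.

Lemma compactification_regular : regular_space S.
Proof.
move=> x; apply: compact_regular compactification_hausdorff compactification_compact _.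
exact: filterT.
Qed.

(** The action on [S] permutes coordinates: coordinate [f] of [g p] is the coordinate of [p] at [f]
    composed with [g]. *)
Let tr g (f : T) : T := SigSub (mem_set (ruc_gact g (set_valP f))).

Let act_closure g (p : S) : D (fun f => coord (tr g f) p).
Proof.
apply/closure_openP => B oB Bp.
have cg : continuous (fun q : S => (fun f => coord (tr g f) q) : {ptws T -> R}).
  by apply: continuous_ptws => f; exact: coord_continuous.
have [||q [Bq [z _ E]]] :=
    @compactify_dense ((fun q : S => (fun f => coord (tr g f) q) : {ptws T -> R}) @^-1` B).
- by exists p.
- by apply: open_comp => // q _; exact: cg.
- by exists (ev (gact g z)); split; [exists (gact g z)|move: Bq; rewrite -E].
Qed.

Let act g (p : S) : S := SigSub (mem_set (@act_closure g p)).

Let coord_act f g p : coord f (act g p) = coord (tr g f) p. Proof. by []. Qed.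

Let act1 p : act 1%g p = p.
Proof.
apply: coord_inj => f; rewrite coord_act; congr (coord _ p).
by apply: val_inj; apply: funext => z /=; rewrite gact1.
Qed.

Let actM g h p : act (g * h)%g p = act g (act h p).
Proof.
apply: coord_inj => f; rewrite !coord_act; congr (coord _ p).
by apply: val_inj; apply: funext => z /=; rewrite gactM.
Qed.

Let act_continuous : continuous (fun q : G * S => act q.1 q.2).
Proof.
apply: continuous_to_compactification => f [g p].
apply/cvgrPdist_le => e e0; have e20 : 0 < e / 2 by lra.
have [_ _ /(_ _ e20) uf] : ruc (set_val f) := set_valP f.
have Vg : nbhs g ((fun h => (h * g^-1)%g) @^-1`
    [set u | forall z, `|set_val f (gact u z) - set_val f z| <= e / 2]).
  by apply: (@mulg_continuousl G g^-1%g g); rewrite mulgV.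
have Vp : nbhs p [set q | `|coord (tr g f) p - coord (tr g f) q| <= e / 2].
  by have /cvgrPdist_le/(_ _ e20) := @coord_continuous (tr g f) p.
exists ([set h | forall z, `|set_val f (gact (h * g^-1)%g z) - set_val f z| <= e / 2],
  [set q | `|coord (tr g f) p - coord (tr g f) q| <= e / 2]) => //.
move=> [h q] [/= Vh Vq].
(* Writing [h] as [(h g^-1) g] bounds this difference uniformly in [q]. *)
have : `|coord (tr h f) q - coord (tr g f) q| <= e / 2.
  by apply: coord_lip => z /=; have := Vh (gact g z); rewrite -gactM -mulgA mulVg mulg1.
move: Vq; rewrite (coord_act f g p) (coord_act f h q).
move=> h1; rewrite distrC => h2.
rewrite -(subrKA (coord (tr g f) q)); apply: le_trans (ler_normD _ _) _; lra.
Qed.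

Definition compactification : gspace G := GSpace act1 actM act_continuous
  compactification_hausdorff compactification_regular.

Lemma compactify_gmap : @gmap G Z compactification compactify.
Proof.
by split=> [|g z]; [exact: compactify_continuous|exact: coord_inj].
Qed.

(** The image of [p] is the point of [Y] at which each continuous [psi] into [[0, 1]] takes the
    value of the coordinate [psi \o h] at [p]. It is a cluster point of [h] along the neighbourhoods
    of [p], unique by Urysohn functions. *)
Lemma compactification_extend (Y : gspace G) (h : Z -> Y) : gflow Y -> gmap h ->
  exists2 k : compactification -> Y, gmap k & forall z, k (compactify z) = h z.
Proof.
move=> cY gh; have [ch eh] := gh; have hY := @gspace_hausdorff G Y.
pose FY := [set psi : Y -> R | continuous psi /\ forall y, 0 <= psi y <= 1].
have rh psi : FY psi -> ruc (psi \o h).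
  by move=> [cpsi psi01]; apply: ruc_comp => //; exact: ruc_flow.
pose c (psi : Y -> R) (Hpsi : FY psi) := coord (SigSub (mem_set (rh psi Hpsi))).
have sep y y' : (forall psi, FY psi -> psi y = psi y') -> y = y'.
  move=> yy'; apply: contrapT => ne.
  have oO : open (~` [set y']) by apply: closed_openC; exact: hausdorff_closed1.
  have [psi [cpsi psi01 y0 y'1]] := @compact_urysohn1 R Y y _ cY hY oO ne.
  have := yy' psi (conj cpsi psi01); rewrite y0 y'1; last by apply.
  by move=> /esym/eqP; rewrite oner_eq0.
have ex (p : S) : exists y, forall psi (Hpsi : FY psi), psi y = c psi Hpsi p.
  pose F := filter_from (nbhs p) (fun V => h @` (compactify @^-1` V)).
  have PF : ProperFilter F.
    apply: filter_from_proper.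
      apply: filter_from_filter; first by exists setT; exact: filterT.
      move=> V W pV pW; exists (V `&` W); first exact: filterI.
      by move=> _ [z [Vz Wz] <-]; split; exists z.
    move=> V; rewrite nbhsE => -[O [oO Op] OV].
    have [|q [Oq [z _ E]]] := compactify_dense _ oO; first by exists p.
    by exists (h z); exists z => //; apply: OV; rewrite E.
  have [y [_ Fy]] := cY F PF filterT.
  exists y => psi Hpsi; have [cpsi _] := Hpsi.
  apply: Rhausdorff => A B Ay Bp.
  have [||_ [[z Vz <-] Ahz]] := Fy (h @` (compactify @^-1` (c psi Hpsi @^-1` B))) (psi @^-1` A).
  - by exists (c psi Hpsi @^-1` B) => //; exact: coord_continuous.
  - exact: cpsi.
  - by exists (psi (h z)).
pose k p := projT1 (cid (ex p)).
have kP p psi (Hpsi : FY psi) : psi (k p) = c psi Hpsi p.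
  by rewrite /k; case: (cid _) => y /= ->.
exists k; last by move=> z; apply: sep => psi Hpsi; rewrite (kP _ _ Hpsi).
split=> [p V|g p].
  rewrite nbhsE => -[O [oO Op] OV].
  have [psi [cpsi psi01 y0 y1]] := @compact_urysohn1 R Y _ _ cY hY oO Op.
  have Hpsi : FY psi by [].
  have : nbhs p (c psi Hpsi @^-1` [set t | t < 1]).
    apply: coord_continuous; rewrite -/(c psi Hpsi p) -kP y0; apply: lt_nbhsl.
    exact: ltr01.
  apply: filterS => q; rewrite /preimage/= -kP => kq; apply: OV; apply: contrapT => nO.
  by move: kq; rewrite y1 ?ltxx.
apply: sep => psi Hpsi; have [cpsi psi01] := Hpsi.
have Hg : FY (psi \o gact g).
  split=> [y|y] //=; first by apply: continuous_comp; [exact: gact_continuousr|exact: cpsi].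
rewrite (kP _ _ Hpsi) -[RHS]/((psi \o gact g) (k p)) (kP _ _ Hg).
rewrite /c [LHS]coord_act; congr (coord _ p); apply: val_inj; apply: funext => z /=.
by rewrite eh.
Qed.

Lemma compactification_universal :
  (forall z (O : set Z), open O -> O z -> exists f : Z -> R, [/\ ruc f, f z = 0 &
    forall y, ~ O y -> f y = 1]) ->
  @universal_compactification G Z compactification compactify.
Proof.
move=> sep; split.
- exact: compactification_compact.
- exact: compactify_gmap.
- split.
    move=> z z' E; apply: contrapT => ne.
    have oO : open (~` [set z']).
      by apply: closed_openC; apply: hausdorff_closed1; exact: gspace_hausdorff.
    have [f [rf z0 z1]] := sep z _ oO ne.
    have : f z = f z' := congr1 (coord (SigSub (mem_set rf))) E.
    rewrite z0 z1; last by apply.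
    by move=> /esym/eqP; rewrite oner_eq0.
  move=> A; split=> [oA|[B oB ->]]; last first.
    by apply: open_comp => // z _; exact: compactify_continuous.
  pose J := [set f : T | [set z | set_val f z < 1] `<=` A].
  exists (\bigcup_(f in J) (coord f @^-1` [set t | t < 1])).
    apply: bigcup_open => f _; apply: open_comp => // p _; exact: coord_continuous.
  rewrite eqEsubset; split=> [z Az|z [f Jf fz]]; last exact: Jf.
  have [f [rf z0 z1]] := sep z A oA Az.
  exists (SigSub (mem_set rf)); last by suff : f z < 1 by []; rewrite z0 ltr01.
  by move=> y /= fy; apply: contrapT => nA; have : f y < 1 := fy; rewrite z1 ?ltxx.
- exact: compactify_dense.
- move=> Y h; exact: compactification_extend.
Qed.

End Construction.
End Compactification.

(** * Ultrafilters on the index set *)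

Section Beta.
Context {I : Type}.
Implicit Types (A : set I) (U V : beta I).

Lemma beta_eq U V : beta_sets U `<=` beta_sets V -> U = V.
Proof.
move=> UV; have E : beta_sets V = beta_sets U by apply: max_filter.
case: U V E {UV} => [U uU] [V uV] /= E; rewrite E in uV *.
by congr Beta; exact: Prop_irrelevance.
Qed.

Lemma open_beta_base A : open (beta_base A).
Proof. by exists [set A] => //; rewrite bigcup_set1. Qed.

Lemma nbhs_beta U N : nbhs U N -> exists2 A, beta_sets U A & beta_base A `<=` N.
Proof.
rewrite nbhsE => -[O [[D _ <-] [A DA UA]] ON]; exists A => // V VA.
by apply: ON; exists A.
Qed.

Lemma beta_not U A : ~ beta_sets U A -> beta_sets U (~` A).
Proof. by have [//|] := in_ultra_setVsetC A (beta_ultra U). Qed.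

Lemma beta_hausdorff : hausdorff_space (beta I).
Proof.
move=> U V cl; apply: beta_eq => A UA; apply: contrapT => /beta_not VA.
have [||W [WA WnA]] := cl (beta_base A) (beta_base (~` A)).
- by apply: open_nbhs_nbhs; split => //; exact: open_beta_base.
- by apply: open_nbhs_nbhs; split => //; exact: open_beta_base.
by have [i []] := filter_ex (filterI WA WnA).
Qed.

End Beta.

(** * The compactification of [I x X] and its projections *)

Section Product_space.
Context {R : realType} {G : topologicalGroupType}.
Variables (I : Type) (X : gspace G).
Hypothesis X_flow : gflow X.
Local Notation Z := (gprod I X).

Lemma nbhs_gprod (i : I) (x : X) (V : set X) : nbhs x V ->
  nbhs ((i, x) : Z) [set p | p.1 = i /\ V p.2].
Proof.
move=> xV; exists ([set (i : discrete_topology {classic I})], V).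
  by split=> //; exact: discrete_set1.
by move=> [j y] [/= -> Vy].
Qed.

Lemma gprod_layer_continuous (i : I) : continuous (fun x : X => (i, x) : Z).
Proof.
move=> x V [[A B] [/= Ai Bx] AB]; apply: (filterS _ Bx) => y By.
by apply: AB; split => //; exact: nbhs_singleton Ai.
Qed.

Lemma snd_gmap : @gmap G Z X snd.
Proof. by split=> // p; exact: cvg_snd. Qed.

(** Continuity is a layerwise condition since [I] is discrete, but the uniformity needs one
    neighbourhood for all layers. *)
Lemma ruc_gprod (F : I -> X -> R) : (forall i, continuous (F i)) ->
  (forall i x, 0 <= F i x <= 1) ->
  (forall e, 0 < e -> nbhs (1%g : G) [set u | forall i x, `|F i (gact u x) - F i x| <= e]) ->
  @ruc R G Z (fun p => F p.1 p.2).
Proof.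
move=> cF F01 uF; split=> [[i x]|p|e e0].
- move=> V /cF/(nbhs_gprod i); rewrite /= => h.
  by apply: filterS h => -[j y] /= [-> Vy].
- exact: F01.
- by apply: filterS (uF e e0) => u Fu [i x]; exact: Fu.
Qed.

Lemma gprod_separation (z : Z) (O : set Z) : open O -> O z -> exists f : Z -> R,
  [/\ ruc f, f z = 0 & forall y, ~ O y -> f y = 1].
Proof.
case: z => i0 x0 oO Oz.
pose O0 := (fun x : X => (i0, x) : Z) @^-1` O.
have oO0 : open O0 by apply: open_comp => // x _; exact: gprod_layer_continuous.
have [h [ch h01 hx hO]] := @compact_urysohn1 R X x0 O0 X_flow (@gspace_hausdorff _ X) oO0 Oz.
exists (fun p => if `[< p.1 = i0 >] then h p.2 else 1); split.
- apply: (@ruc_gprod (fun i x => if `[< i = i0 >] then h x else 1)).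
  + by move=> i; case: asboolP => // _; exact: cst_continuous.
  + by move=> i x; case: asboolP => // _; rewrite ler01 lexx.
  + move=> e e0; have [_ _ uh] := ruc_flow X_flow ch h01.
    apply: filterS (uh e e0) => u hu i x; case: asboolP => // _.
    by rewrite subrr normr0 ltW.
- by rewrite /= asboolT.
- move=> [i x] nO /=; case: asboolP => // E; apply: hO; rewrite /O0 /preimage/= -E.
  exact: nO.
Qed.

Local Notation S := (@compactification R G Z).
Local Notation inj := (@compactify R G Z).

(** As a coordinate of [S], this indicator avoids 0 or avoids 1 near each point. Hence every point
    decides every set of layers, which makes [layers p] an ultrafilter. *)
Let chi (A : set I) (p : Z) : R := if `[< A p.1 >] then 1 else 0.

Let ruc_chi A : ruc (chi A).
Proof.
apply: (@ruc_gprod (fun i x => if `[< A i >] then 1 else 0)).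
- by move=> i; exact: cst_continuous.
- by move=> i x; case: ifP => _; rewrite ?lexx ?ler01.
- move=> e e0; apply: filterS (@filterT _ (nbhs (1%g : G)) _) => u _ i x.
  by rewrite subrr normr0 ltW.
Qed.

Let layers (p : S) : set_system I :=
  filter_from (nbhs p) (fun V => [set i | exists x, V (inj (i, x))]).

Let layers_proper p : ProperFilter (layers p).
Proof.
apply: filter_from_proper.
  apply: filter_from_filter; first by exists setT; exact: filterT.
  move=> V W pV pW; exists (V `&` W); first exact: filterI.
  by move=> i [x [Vx Wx]]; split; exists x.
move=> V; rewrite nbhsE => -[O [oO Op] OV].
have [|q [Oq [[i x] _ E]]] := @compactify_dense R G Z O _ oO; first by exists p.
by exists i, x; apply: OV; rewrite E.
Qed.

Let layers_chi p A : layers p A \/ layers p (~` A).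
Proof.
pose c : S -> R := coord (SigSub (mem_set (ruc_chi A))).
have cc : continuous c by exact: coord_continuous.
have cE i x : c (inj (i, x)) = if `[< A i >] then 1 else 0 by [].
have nb r : c p != r -> nbhs p (c @^-1` (~` [set r])).
  move=> cpr; apply: open_nbhs_nbhs; split; last exact/eqP.
  apply: open_comp => [q _|]; first exact: cc.
  by apply: closed_openC; apply: hausdorff_closed1; exact: Rhausdorff.
have [c0|/nb N] := eqVneq (c p) 0; [right|left].
  have /nb N : c p != 1 by rewrite c0 eq_sym oner_eq0.
  exists (c @^-1` (~` [set 1])) => // i [x]; rewrite /preimage/= cE.
  by case: asboolP.
exists (c @^-1` (~` [set 0])) => // i [x]; rewrite /preimage/= cE.
by case: asboolP.
Qed.

Let layers_ultra p : UltraFilter (layers p).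
Proof.
split; first exact: layers_proper.
move=> H PH pH; rewrite eqEsubset; split=> // A HA.
have [//|/pH HnA] := layers_chi p A.
by have [i []] := filter_ex (filterI HA HnA).
Qed.

Let fst_ext (p : S) : beta I := Beta (layers_ultra p).

Let fst_ext_continuous : continuous fst_ext.
Proof.
move=> p N /nbhs_beta[A [V pV VA] AN].
have : nbhs p V° by exact: nbhs_interior.
apply: filterS => q Vq; apply: AN; exists V => //; exact: Vq.
Qed.

Let fst_extE i x : fst_ext (inj (i, x)) = beta_principal i.
Proof.
apply: beta_eq => A [V ixV VA]; apply/principal_filterP; apply: VA; exists x.
exact: nbhs_singleton ixV.
Qed.

(** In this realization the [ruc] functions are coordinates, so they extend. One realization
    suffices later, since uniqueness of the minimal subflow is assumed for all of them. *)
Lemma SG_exists : exists S : SG I X,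
  forall f : Z -> R, ruc f -> exists2 h : S -> R, continuous h &
    forall z, h (SG_inj S z) = f z.
Proof.
have [pi [cpi _] piE] := compactification_extend (R := R) X_flow snd_gmap.
exists (MkSG (compactification_universal gprod_separation) fst_ext_continuous fst_extE
  cpi (fun i x => piE (i, x))) => f rf; exists (coord (SigSub (mem_set rf))) => //; exact: coord_continuous.
Qed.

End Product_space.

(** * Ultracopowers *)

Lemma minimal_subflow_exists (G : topologicalGroupType) (Y : gspace G) (K : set Y) :
  gflow Y -> subflow K -> exists2 M : set Y, minimal_subflow M & M `<=` K.
Proof.
move=> cY sK.
(* Zorn's lemma is stated for unions, so it is applied to the complements of subflows in [K]. *)
pose P (O : set Y) := O `<=` K /\ subflow (K `\` O).
have [F FP totF|O [[OK sO] maxO]] := @Zorn_bigcup Y P.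
  have [->|/set0P F0] := eqVneq F set0.
    by rewrite bigcup_set0; split; [exact: sub0set|rewrite setD0].
  split; first by move=> x [O /FP[OK _] Ox]; exact: OK.
  have E : K `\` \bigcup_(O in F) O = \bigcap_(A in [set K `\` O | O in F]) A.
    rewrite eqEsubset; split=> [x [Kx nx] _ [O FO <-]|x Fx].
      by split => // Ox; apply: nx; exists O.
    have [O0 FO0] := F0; have [Kx _] := Fx _ (ex_intro2 _ _ O0 FO0 erefl).
    split => // -[O FO Ox]; have [_ nOx] := Fx _ (ex_intro2 _ _ O FO erefl).
    exact: nOx.
  rewrite E; split.
  - apply: (@compact_closed_chain Y setT) => //.
    + by have [O FO] := F0; exists (K `\` O); exists O.
    + by move=> _ [O /FP[_ [? ? ?]] <-]; split.
    + move=> _ _ [O FO <-] [O' FO' <-].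
      by have [OO'|O'O] := totF _ _ FO FO'; [right|left]; apply: setDS.
  - by apply: closed_bigI => _ [O /FP[_ [_ ? _]] <-].
  - move=> g x Fx _ [O FO <-]; have [_ [_ _ iO]] := FP _ FO; apply: iO.
    by apply: Fx; exists O.
exists (K `\` O); last by move=> x [].
split => // N sN NO; rewrite eqEsubset; split => // x [Kx nOx]; apply: contrapT => nNx.
have NK : N `<=` K by move=> y /NO[].
apply: (maxO (K `\` N)); last first.
  by split=> [y []//|]; rewrite setDD (_ : K `&` N = N)//; exact/setIidPr.
split=> [y Oy|/(_ x (conj Kx nNx))//].
by split; [exact: OK|move=> /NO[]].
Qed.

Section Vietoris.
Context {Y : topologicalType}.

Lemma open_vietoris_sub (O : set Y) : open O -> open [set K : hyperspace Y | K `<=` O].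
Proof.
move=> oO; exists [set [set K : hyperspace Y | K `<=` O]]; last by rewrite bigcup_set1.
by move=> _ ->; exact: (@finI_from1 _ _ _ vietoris_subbase (true, O)).
Qed.

(** Near a singleton both kinds of subbasic condition reduce to inclusion: a nonempty set inside [O]
    also meets [O]. *)
Lemma nbhs_hyper1 (y : Y) (V : set (hyperspace Y)) : nbhs (hyper1 y) V ->
  exists O : set Y, [/\ open O, O y & forall K : hyperspace Y, K `<=` O -> V K].
Proof.
rewrite nbhsE => -[B [[D' D'fin <-] [E D'E yE]] BV].
have [F Fopen FE] := D'fin _ D'E.
have iy i : i \in F -> open i.2 /\ i.2 y.
  move=> iF; have oi : open i.2 by have := Fopen i iF; rewrite inE.
  split=> //; move: yE; rewrite -FE => /(_ i iF); clear Fopen FE.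
  by case: i iF oi => -[] O iF oi /=; [apply|move=> [z [-> ]]].
have : nbhs y (\bigcap_(i in [set` F]) i.2).
  by apply: filter_bigI => i /iy; exact: open_nbhs_nbhs.
rewrite nbhsE => -[O [oO Oy] OF]; exists O; split => // K KO.
suff EK : E K by apply: BV; exists E.
rewrite -FE => -[[] B'] iF /=; first by move=> z /KO/OF/(_ _ iF).
by have [z Kz] := hyper_neq0 K; exists z; split => //; exact: (OF z (KO z Kz) _ iF).
Qed.

End Vietoris.

Section Ultracopower.
Context {G : topologicalGroupType} {X : gspace G} {I : Type}.
Variables (S : SG I X) (U : beta I).
Hypothesis X_flow : gflow X.
Local Notation inj := (SG_inj S).
Local Notation Sigma := (ultracopower S U).

Lemma SG_flow : gflow S. Proof. by have [] := SG_universal S. Qed.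

Lemma SG_inj_gmap : gmap inj. Proof. by have [] := SG_universal S. Qed.

Lemma SG_inj_dense : dense (range inj). Proof. by have [] := SG_universal S. Qed.

Lemma SG_inj_gact g i x : gact g (inj (i, x)) = inj (i, gact g x).
Proof. by have [_ eq_inj] := SG_inj_gmap; rewrite -eq_inj. Qed.

Lemma SG_layer_continuous i : continuous (fun x => inj (i, x)).
Proof.
move=> x; apply: (@continuous_comp _ (gprod I X) S (fun x => (i, x) : gprod I X)).
  exact: gprod_layer_continuous.
by have [ci _] := SG_inj_gmap; exact: ci.
Qed.

Lemma SG_fst_gact g p : SG_fst S (gact g p) = SG_fst S p.
Proof.
apply: (@eq_on_dense S (beta I) (fun p => SG_fst S (gact g p)) (SG_fst S)).
- exact: beta_hausdorff.
- exact: SG_inj_dense.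
- move=> q; apply: (@continuous_comp _ _ _ (gact g)); first exact: gact_continuousr.
  exact: SG_fst_continuous.
- exact: SG_fst_continuous.
- by move=> _ [[i x] _ <-]; rewrite SG_inj_gact !SG_fstE.
Qed.

Lemma SG_snd_gact g p : SG_snd S (gact g p) = gact g (SG_snd S p).
Proof.
apply: (@eq_on_dense S X (fun p => SG_snd S (gact g p)) (fun p => gact g (SG_snd S p))).
- exact: gspace_hausdorff.
- exact: SG_inj_dense.
- move=> q; apply: (@continuous_comp _ _ _ (gact g)); first exact: gact_continuousr.
  exact: SG_snd_continuous.
- move=> q; apply: (@continuous_comp _ _ _ (SG_snd S)); first exact: SG_snd_continuous.
  exact: gact_continuousr.
- by move=> _ [[i x] _ <-]; rewrite SG_inj_gact !SG_sndE.
Qed.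

Lemma closed_ultracopower : closed Sigma.
Proof.
apply: (@closed_comp _ _ (SG_fst S)); first by move=> p _; exact: SG_fst_continuous.
by apply: hausdorff_closed1; exact: beta_hausdorff.
Qed.

Lemma ultracopower_gact g p : Sigma p -> Sigma (gact g p).
Proof. by move=> Up; rewrite /ultracopower /preimage/= SG_fst_gact. Qed.

(** Otherwise [p] would have a neighbourhood inside [V] that meets [I x X] only in layers avoiding
    [V], against density. *)
Lemma ultracopower_slices p (V : set S) : Sigma p -> nbhs p V ->
  beta_sets U [set i | exists x, V (inj (i, x))].
Proof.
move=> Up pV; apply: contrapT => /beta_not UnJ; set J := [set i | _] in UnJ.
have : nbhs p (V `&` SG_fst S @^-1` beta_base (~` J)).
  apply: filterI => //; apply: SG_fst_continuous; rewrite Up.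
  by apply: open_nbhs_nbhs; split; [exact: open_beta_base|].
rewrite nbhsE => -[O [oO Op] OV].
have [|q [Oq [[i x] _ E]]] := SG_inj_dense _ oO; first by exists p.
have [Vq] := OV _ Oq; rewrite /preimage/= -E SG_fstE => /principal_filterP.
by apply; exists x; rewrite E.
Qed.

(** A cluster point of the chosen points along [U] inherits every closed condition that holds in
    [U]-many layers. *)
Lemma ultracopower_limit (x : I -> X) : exists2 p, Sigma p &
  forall C : set S, closed C -> beta_sets U [set i | C (inj (i, x i))] -> C p.
Proof.
have [p [_ Fp]] := @SG_flow ((fun i => inj (i, x i)) @ beta_sets U) _ filterT.
have HC (C : set S) : closed C -> beta_sets U [set i | C (inj (i, x i))] -> C p.
  by move=> cC UC; apply: cC => V pV; exact: Fp.
exists p => //; apply/esym/beta_eq => A UA; apply: contrapT => /beta_not pnA.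
have FA : beta_sets U [set i | [set q | exists2 i, A i & inj (i, x i) = q] (inj (i, x i))].
  by apply: filterS UA => i Ai; exists i.
have [|q [[i Ai <-]]] := Fp _ (SG_fst S @^-1` beta_base (~` A)) FA.
  apply: SG_fst_continuous; apply: open_nbhs_nbhs; split => //.
  exact: open_beta_base.
by rewrite /preimage/= SG_fstE => /principal_filterP.
Qed.

Lemma subflow_ultracopower : [set: X] !=set0 -> subflow Sigma.
Proof.
move=> [x _]; split; [|exact: closed_ultracopower|exact: ultracopower_gact].
by have [p Up _] := ultracopower_limit (fun=> x); exists p.
Qed.

Section Thickness.
Context {R : realType}.

(** Disjoint [M] and [N] are separated by [h], which changes by at most [1/4] under [W]. Some layer
    has open [A], [B] with [h < 1/4] on [F A] and [h > 3/4] on [F B]; a common point of [W F A] and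
    [W F B] would have [h] on both sides of [1/2]. *)
Lemma thickness_unique_minimal : [set: X] !=set0 -> thickness_condition X ->
  exists! M : set S, minimal_subflow M /\ M `<=` Sigma.
Proof.
move=> X0 HT.
have [M mM MS] := minimal_subflow_exists SG_flow (subflow_ultracopower X0).
exists M; split => // N [mN NS].
have [[M0 cM iM] minM] := mM; have [[N0 cN iN] minN] := mN.
have [MN0|/set0P MN0] := eqVneq (M `&` N) set0; last first.
  have sMN : subflow (M `&` N).
    by split => //; [exact: closedI|move=> g x [Mx Nx]; split; [exact: iM|exact: iN]].
  by rewrite -(minM _ sMN (@subIsetl _ _ _)) [LHS](minN _ sMN (@subIsetr _ _ _)).
exfalso; move/disjoints_subset: MN0 => MN.
have [h [ch h01 hM hN]] := @compact_urysohn R S M (~` N) SG_flow (@gspace_hausdorff _ S)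
  cM (closed_openC cN) MN.
have q0 : 0 < 4%:R^-1 :> R by lra.
have [_ _ /(_ _ q0) /symmetric_nbhd_sub[W sW hW]] := ruc_flow SG_flow ch h01.
have [F fF HF] := HT W sW.
have nbF (L : set S) (V : set S) : (forall g x, L x -> L (gact g x)) -> open V ->
    L `<=` V -> L !=set0 -> L `<=` Sigma -> beta_sets U [set i | exists A : set X,
    [/\ open A, A !=set0 & forall f a, F f -> A a -> V (inj (i, gact f a))]].
  move=> iL oV LV [p Lp] LS.
  have : nbhs p (\bigcap_(f in F) (gact f @^-1` V)).
    apply: filter_finite_bigcap => // f _; apply: gact_continuousr.
    by apply: open_nbhs_nbhs; split => //; apply: LV; exact: iL.
  move=> /nbhs_interior/(ultracopower_slices (LS _ Lp)); apply: filterS => i [x Vx].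
  exists ((fun x => inj (i, x)) @^-1` (\bigcap_(f in F) (gact f @^-1` V))°); split.
  - by apply: open_comp; [move=> y _; exact: SG_layer_continuous|exact: open_interior].
  - by exists x.
  - move=> f a Ff /interior_subset/(_ f Ff).
    by rewrite /preimage/= SG_inj_gact.
have oh (t : set R) : open t -> open (h @^-1` t).
  by move=> ot; apply: open_comp => // x _; exact: ch.
have UM MV := nbF M (h @^-1` [set t | t < 4%:R^-1]) iM (oh _ (@open_lt R _)) MV M0 MS.
have UN NV := nbF N (h @^-1` [set t | 3%:R * 4%:R^-1 < t]) iN (oh _ (@open_gt R _)) NV N0 NS.
have MV : M `<=` h @^-1` [set t | t < 4%:R^-1].
  by move=> x Mx; rewrite /preimage/= hM //; lra.
have NV : N `<=` h @^-1` [set t | 3%:R * 4%:R^-1 < t].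
  by move=> x Nx; rewrite /preimage/= hN; [lra|by apply].
have [i [[A [oA A0 FA]] [B [oB B0 FB]]]] := filter_ex (filterI (UM MV) (UN NV)).
have [x [[w Ww [_ [f Ff [a Aa <-]] Ex]] [w' Ww' [_ [f' Ff' [b Bb <-]] Ex']]]] :=
  HF A B oA A0 oB B0.
have := hW w Ww (inj (i, gact f a)); have := hW w' Ww' (inj (i, gact f' b)).
have := FA f a Ff Aa; have := FB f' b Ff' Bb.
rewrite /preimage/= !SG_inj_gact Ex Ex' !ler_distl => h1 h2 /andP[h3 h4] /andP[h5 h6].
lra.
Qed.

End Thickness.

(** Since [X] is minimal, every subflow of the ultracopower maps onto [X] and meets the fibre over
    [x]. The limit [y] of the contracted fibre then lies in all subflows, so minimal ones
    coincide. *)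
Lemma highly_proximal_unique_minimal : minimal X ->
  highly_proximal Sigma (SG_snd S) ->
  exists! M : set S, minimal_subflow M /\ M `<=` Sigma.
Proof.
move=> [[[x Xx] _ _] minX] [_ _ _ /(_ x)[K KE [D [le [g [y [[[d1] le_refl _ _] gy]]]]]]].
have Ny (N : set S) : subflow N -> N `<=` Sigma -> N y.
  move=> [[p Np] cN iN] NS; apply: (cN) => V; rewrite nbhsE => -[O [oO Oy] OV].
  have [|d0 /(_ d0 (le_refl d0)) gO] := gy [set L : hyperspace S | L `<=` O].
    by apply: open_nbhs_nbhs; split; [exact: open_vietoris_sub|move=> _ ->].
  have [m Nm mx] : (SG_snd S @` N) x.
    rewrite (minX (SG_snd S @` N))//; split; first by exists (SG_snd S p); exists p.
      apply: compact_closed; first exact: gspace_hausdorff.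
      apply: continuous_compact.
        by apply: continuous_subspaceT; exact: SG_snd_continuous.
      exact: (subclosed_compact cN SG_flow).
    by move=> h _ [q Nq <-]; rewrite -SG_snd_gact; exists (gact h q) => //; exact: iN.
  exists (gact (g d0) m); split; first exact: iN.
  by apply/OV/gO; exists m => //; rewrite KE; split => //; exact: NS.
have [M mM MS] := minimal_subflow_exists SG_flow (subflow_ultracopower (ex_intro _ x Xx)).
exists M; split => // N [mN NS].
have [[_ cM iM] minM] := mM; have [[_ cN iN] minN] := mN.
have sMN : subflow (M `&` N).
  split; [|exact: closedI|by move=> h z [Mz Nz]; split; [exact: iM|exact: iN]].
  by exists y; split; apply: Ny => //; [exact: mM.1|exact: mN.1].
by rewrite -(minM _ sMN (@subIsetl _ _ _)) [LHS](minN _ sMN (@subIsetr _ _ _)).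
Qed.

Lemma ultracopower_snd_surj x : exists2 p, Sigma p & SG_snd S p = x.
Proof.
have [p Sp HC] := ultracopower_limit (fun=> x); exists p => //.
apply: (HC (SG_snd S @^-1` [set x])).
  apply: (@closed_comp _ _ (SG_snd S)); first by move=> q _; exact: SG_snd_continuous.
  by apply: hausdorff_closed1; exact: gspace_hausdorff.
by apply: filterE => i; rewrite /preimage/= SG_sndE.
Qed.

(* If [V] is a neighbourhood of the minimal subflow's point [y], choose [V'], [W] *)
(* with [cl(W V')] inside [V]; finitely many translates [f V'] cover the          *)
(* ultracopower, and a set [A] that is TT for the conjugates of [W] has all its   *)
(* fibres over some [f^-1 A] inside [cl(W V')].                                   *)
Lemma unique_minimal_highly_proximal : minimal X ->
  (forall W : set G, symmetric_nbhd W -> somewhere_TT W [set: X]) ->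
  (exists! M : set S, minimal_subflow M /\ M `<=` Sigma) ->
  highly_proximal Sigma (SG_snd S).
Proof.
move=> mX HTT [M [[mM MS] uM]].
have [[[y My] _ _] _] := mM.
have shrink V : open V -> V y -> exists A : set X, [/\ open A, A !=set0 &
    forall q, Sigma q -> A (SG_snd S q) -> V q].
  move=> oV Vy.
  have [V1 V1y clV1] := @gspace_regular _ S y V (open_nbhs_nbhs (conj oV Vy)).
  have /= := @gact_continuous G S (1%g, y) V1; rewrite gact1 => /(_ V1y)[[W0 V0] /= [W01 V0y] WV0].
  have [W sW WW0] := symmetric_nbhd_sub W01.
  have WV : closure (setact W V0°) `<=` V.
    apply: subset_trans clV1; apply: closureS => _ [w Ww [v /interior_subset Vv <-]].
    by apply: (WV0 (w, v)); split => //; exact: WW0.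
  have oV0 : open V0° by exact: open_interior.
  have [|F fF FS] := subflow_cover (subclosed_compact closed_ultracopower SG_flow (@subsetT _ _))
      closed_ultracopower ultracopower_gact oV0.
    move=> N sN NS; have [N' mN' N'N] := minimal_subflow_exists SG_flow sN.
    exists y; split; last exact: V0y.
    have MN' : M = N' by apply: uM; split => // z /N'N/NS.
    by apply: N'N; rewrite -MN'.
  have [W' sW' W'F] := conj_nbhd fF (symmetric_nbhd_nbhs sW).
  have [A _ [oA [a Aa] WA]] := HTT W' sW'.
  have [p Sp pa] := ultracopower_snd_surj a.
  have /setactP[f Ff V0p] := FS p Sp.
  have oSA : open (SG_snd S @^-1` A) by apply: open_comp => // q _; exact: SG_snd_continuous.
  have ofV : open (gact f @` V0°) by exact: gact_open.
  have UJ : beta_sets U [set i | exists x, (SG_snd S @^-1` A `&` gact f @` V0°) (inj (i, x))].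
    apply: (ultracopower_slices Sp); apply: open_nbhs_nbhs; split; first exact: openI.
    split; first by rewrite /preimage/= pa. by exists (gact f^-1%g p); rewrite ?gactVK.
  exists (gact f^-1%g @` A); split; first exact: gact_open.
    by exists (gact f^-1%g a); exists a.
  move=> q Sq [b Ab fb]; apply: WV; apply/closure_openP => Q oQ Qq.
  have ofQ : open (gact f @` Q) by exact: gact_open.
  (* In a common layer [i], the part of [A] lying in [f V0] is open and nonempty, so the TT property
     brings a [W']-translate of one of its points into [f Q]. *)
  have /(filterI UJ)/filter_ex[i [[x [Ax Vx]] [x' [Ax' Qx']]]] :
      beta_sets U [set i | exists x, (SG_snd S @^-1` A `&` gact f @` Q) (inj (i, x))].
    apply: (ultracopower_slices (ultracopower_gact f Sq)); apply: open_nbhs_nbhs.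
    split; first exact: openI.
    by split; [rewrite /preimage/= SG_snd_gact -fb gactVK|exists q].
  rewrite /preimage/= SG_sndE in Ax; rewrite /preimage/= SG_sndE in Ax'.
  have olayer (O : set S) : open O -> open ((fun z => inj (i, z)) @^-1` O).
    by move=> oO; apply: open_comp => // z _; exact: SG_layer_continuous.
  have := WA (A `&` (fun z => inj (i, z)) @^-1` (gact f @` V0°))
    (openI oA (olayer _ ofV)) (ex_intro _ x (conj Ax Vx)) (@subIsetl _ _ _) x' Ax'.
  move=> /closure_openP/(_ _ (olayer _ ofQ) Qx').
  move=> [_ [[w W'w [c [Ac [v Vv fv]] <-]] [t Qt ft]]].
  exists t; split=> //; exists (f^-1 * w * f)%g; first exact: W'F.
  exists v => //; rewrite !gactM fv SG_inj_gact.
  by rewrite -ft gactK.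
split.
- by apply: continuous_subspaceT; exact: SG_snd_continuous.
- by move=> g q _; exact: SG_snd_gact.
- by rewrite eqEsubset; split => // x _; have [p Sp px] := ultracopower_snd_surj x; exists p.
move=> x.
have K0 : (Sigma `&` SG_snd S @^-1` [set x]) !=set0.
  by have [p Sp px] := ultracopower_snd_surj x; exists p.
have cK : compact (Sigma `&` SG_snd S @^-1` [set x]).
  apply: (subclosed_compact _ SG_flow) => //; apply: closedI; first exact: closed_ultracopower.
  apply: (@closed_comp _ _ (SG_snd S)); first by move=> q _; exact: SG_snd_continuous.
  by apply: hausdorff_closed1; exact: gspace_hausdorff.
exists (Hyperspace K0 cK) => //.
(* The contracting net is indexed by the open neighbourhoods of [y] under reverse inclusion. *)
pose D := {V : set S | open V /\ V y}.
have ex_g (d : D) : exists g, gact g @` (Sigma `&` SG_snd S @^-1` [set x]) `<=` sval d.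
  case: d => V [oV Vy] /=; have [A [oA A0 AV]] := shrink V oV Vy.
  have [F _ FA] := minimal_cover X_flow mX oA A0.
  have : [set: X] x by [].
  rewrite -FA => /setactP[h _ Ahx]; exists h^-1%g => _ [q [Sq qx] <-].
  by apply: AV; [exact: ultracopower_gact|rewrite SG_snd_gact qx].
exists D, (fun d d' => sval d' `<=` sval d), (fun d => projT1 (cid (ex_g d))), y; split.
  split=> //.
  - by apply: inhabits; exists setT; split => //; exact: openT.
  - by move=> a.
  - by move=> a b c ab bc; exact: subset_trans bc ab.
  - move=> [A [oA Ay]] [B [oB By]].
    by exists (exist _ (A `&` B) (conj (openI oA oB) (conj Ay By))) => /= z [].
move=> V /nbhs_hyper1[O [oO Oy OV]]; exists (exist _ O (conj oO Oy)) => d /= dO.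
by apply: OV; apply: subset_trans dO; exact: (projT2 (cid (ex_g d))).
Qed.

End Ultracopower.

(** * From ultracopowers to thickness *)

Section Distance_to_open_set.
Context {R : realType} {G : topologicalGroupType} {X : gspace G}.
Variables (s : G -> R) (A : set X).
Hypotheses (s_SN : SN s) (X_GED : GED X) (A_open : open A).

(* [x] is at distance at most [c] from [A] iff it lies in [cl(B_s(c') A)] for all *)
(* [c' > c]; for G-ED spaces the truncated distance is continuous.                *)
Definition radii (x : X) : set R :=
  [set c | c = 1 \/ 0 < c /\ closure (setact (sball s c) A) x].

Definition dist_to (x : X) : R := inf (radii x).

Lemma dist_to_le x c : radii x c -> dist_to x <= c.
Proof.
by apply: ge_inf; exists 0 => r [->//|[/ltW]].
Qed.

Lemma dist_to_ge x c : (forall r, radii x r -> c <= r) -> c <= dist_to x.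
Proof. by move=> cr; apply: lb_le_inf => //; exists 1; left. Qed.

Lemma dist_to_itv x : 0 <= dist_to x <= 1.
Proof.
by rewrite dist_to_ge ?dist_to_le//; [left|move=> r [->//|[/ltW]]].
Qed.

Lemma dist_to_lt x c : dist_to x < c -> exists2 r, radii x r & r < c.
Proof. by apply: inf_lt; exists 1; left. Qed.

Lemma dist_to_gact g x : `|dist_to (gact g x) - dist_to x| <= s g.
Proof.
have [_ [_ s0] _ sV _] := s_SN.
suff le h y : dist_to (gact h y) <= s h + dist_to y.
  rewrite ler_distl; apply/andP; split; last by rewrite addrC le.
  by rewrite lerBlDl -(sV g); have := le g^-1%g (gact g x); rewrite gactK.
rewrite -lerBlDl; apply: dist_to_ge => r; rewrite lerBlDl.
move=> [->|[r0 yr]].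
  by apply: (@le_trans _ _ 1); [by have /andP[] := dist_to_itv (gact h y)|rewrite lerDr].
apply: dist_to_le; right; split; first by have := s0 h; lra.
apply/closure_openP => O oO Ohy.
have [|_ [[k sk [a Aa <-]] Oka]] := (closure_openP _ _).1 yr (gact h @^-1` O) _ Ohy.
  by apply: open_comp => // z _; exact: gact_continuousr.
exists (gact h (gact k a)); split => //; exists (h * k)%g; last by exists a; rewrite ?gactM.
have [_ _ _ _ sM] := s_SN; apply: le_lt_trans (sM h k) _.
by rewrite ltrD2l.
Qed.

Lemma dist_to0 x : A x -> dist_to x = 0.
Proof.
move=> Ax; apply/eqP; rewrite eq_le; have /andP[-> _] := dist_to_itv x; rewrite andbT.
apply/ler_addgt0Pl => e e0; rewrite addr0; apply: dist_to_le; right; split => //.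
apply: subset_closure; exists 1%g; last by exists x; rewrite ?gact1.
by rewrite /sball/=; have [_ _ -> _ _] := s_SN.
Qed.

Lemma dist_to1 B x : open B -> setact (sball s 1) A `&` B = set0 -> B x -> dist_to x = 1.
Proof.
move=> oB AB Bx; apply/eqP; rewrite eq_le; have /andP[_ ->] := dist_to_itv x => /=.
apply: dist_to_ge => r [->//|[r0 xr]]; rewrite leNgt; apply/negP => r1.
have [_ [[g sg [a Aa <-]] Bga]] := (closure_openP _ _).1 xr B oB Bx.
suff : (setact (sball s 1) A `&` B) (gact g a) by rewrite AB.
by split => //; exists g; [exact: lt_trans sg r1|exists a].
Qed.

(** The lower bound comes from closedness of the sets defining [radii]; the upper bound is where
    [G]-ED enters, at the cost of widening the radius by [e / 2]. *)
Lemma dist_to_continuous : continuous dist_to.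
Proof.
move=> x; apply/cvgrPdist_le => e e0; have e20 : 0 < e / 2 by lra.
have sub c d : c <= d -> closure (setact (sball s c) A) `<=` closure (setact (sball s d) A).
  move=> cd; apply: closureS; apply: setactS => // g; rewrite /sball/= => gc.
  exact: lt_le_trans gc cd.
have up : \forall y \near x, dist_to y <= dist_to x + e.
  have [|r [->|[r0 xr]] re] := @dist_to_lt x (dist_to x + e / 2); first by lra.
    by near=> y; have /andP[_] := dist_to_itv y; lra.
  have := X_GED (setact_open (sball s r) A_open) (nbhs_sball s_SN e20) xr.
  rewrite /interior; apply: filterS => y /(closureS (setact_sballD s_SN)) yr.
  by apply: (@le_trans _ _ (e / 2 + r)); [apply: dist_to_le; right; split => //; lra|lra].
have down : \forall y \near x, dist_to x - e <= dist_to y.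
  have [c0|c0] := leP (dist_to x - e) 0.
    by near=> y; have /andP[] := dist_to_itv y; lra.
  have nx : (~` closure (setact (sball s (dist_to x - e)) A)) x.
    move=> xc; have : dist_to x <= dist_to x - e by apply: dist_to_le; right.
    by lra.
  have : nbhs x (~` closure (setact (sball s (dist_to x - e)) A)).
    by apply: open_nbhs_nbhs; split => //; apply: closed_openC; exact: closed_closure.
  apply: filterS => y ny; apply: dist_to_ge => r [->|[r0 yr]].
    by have /andP[_] := dist_to_itv x; lra.
  by rewrite leNgt; apply/negP => rc; apply: ny; apply: sub yr; exact: ltW.
near=> y; rewrite distrC ler_distl; apply/andP; split; first by near: y.
by near: y.
Unshelve. all: by end_near.
Qed.

End Distance_to_open_set.

Lemma unique_minimal_thickness (R : realType) (G : topologicalGroupType) (X : gspace G) :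
  gflow X -> GED X -> [set: X] !=set0 ->
  (forall (I : Type) (U : beta I) (S : SG I X),
     exists! M : set S, minimal_subflow M /\ M `<=` ultracopower S U) ->
  thickness_condition X.
Proof.
move=> cX gX X0 HU W sW; apply: contrapT => nF.
(* Finiteness is placed under the existential, with a dummy pair for infinite [F], so that a pair
   can be chosen for every [F]. *)
have badF (F : set G) : exists AB : set X * set X, finite_set F ->
    [/\ open AB.1, AB.1 !=set0, open AB.2, AB.2 !=set0 &
     setact W (setact F AB.1) `&` setact W (setact F AB.2) = set0].
  apply: contrapT => nAB; apply: nF; exists F.
    by apply: contrapT => nfF; apply: nAB; exists (set0, set0).
  move=> A B oA A0 oB B0; apply/set0P/negP => /eqP AB.
  by apply: nAB; exists (A, B).
pose A F := (projT1 (cid (badF F))).1; pose B F := (projT1 (cid (badF F))).2.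
have AB F : finite_set F -> [/\ open (A F), A F !=set0, open (B F), B F !=set0 &
    setact W (setact F (A F)) `&` setact W (setact F (B F)) = set0].
  by move=> fF; rewrite /A /B; case: (cid _) => -[A' B'] /= /(_ fF).
have [s sSN sW1] := seminorm_in_nbhd R (symmetric_nbhd_nbhs sW).
have [FF [PF FFfin FFg]] := finite_sets_filter G.
have [U0 [U0u FFU]] := ultraFilterLemma PF.
pose U := Beta U0u.
have [S Sext] := @SG_exists R G (set G) X cX.
(* The value 0 on layers with [F] infinite is arbitrary, since [U] contains the set of finite
   [F]. *)
pose phi (F : set G) : X -> R :=
  if pselect (finite_set F) is left _ then dist_to s (setact F (A F)) else (fun=> 0).
have [h ch hE] : exists2 h : S -> R, continuous h & forall z, h (SG_inj S z) = phi z.1 z.2.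
  apply: Sext; apply: ruc_gprod.
  - move=> F; rewrite /phi; case: pselect => [fF|_]; last exact: cst_continuous.
    by apply: dist_to_continuous => //; apply: setact_open; have [] := AB F fF.
  - by move=> F x; rewrite /phi; case: pselect => [fF|_]; [exact: dist_to_itv|rewrite lexx ler01].
  - move=> e e0; apply: filterS (nbhs_sball sSN e0) => u; rewrite /sball/= => ue F x.
    rewrite /phi; case: pselect => _; last by rewrite subrr normr0 ltW.
    by apply: le_trans (ltW ue); exact: dist_to_gact.
have Ufin : beta_sets U (@finite_set G) by exact: FFU.
have Ug g : beta_sets U [set F | F g] by exact: FFU.
have [x0 _] := X0.
have pick (C : set G -> set X) : (forall F, finite_set F -> C F !=set0) ->
    exists c : set G -> X, forall F, finite_set F -> C F (c F).
  move=> C0; exists (fun F => xget x0 (C F)) => F /C0[c Cc]; exact: xgetPex (ex_intro _ c Cc).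
have mk (r : R) (C : set G -> set X) : (forall F, finite_set F -> C F !=set0) ->
    (forall F g x, finite_set F -> F g -> C F x -> phi F (gact g x) = r) ->
    exists M : set S, [/\ minimal_subflow M, M `<=` ultracopower S U &
      forall q, M q -> h q = r].
  move=> /pick[c cC] Cr; have [p Up HC] := ultracopower_limit S U c.
  (* The points on whose whole orbit [h] equals [r]. The limit of the points [c F] is among them
     because each [g] belongs to [U]-many [F]. *)
  pose L := ultracopower S U `&` \bigcap_(g in [set: G]) (fun q => h (gact g q)) @^-1` [set r].
  have cL : closed L.
    apply: closedI; first exact: closed_ultracopower.
    apply: closed_bigI => g _; apply: (@closed_comp _ _ (fun q => h (gact g q))).
      move=> q _; apply: (@continuous_comp _ _ _ (gact g)); first exact: gact_continuousr.
      exact: ch.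
    by apply: hausdorff_closed1; exact: Rhausdorff.
  have [|M mM ML] := @minimal_subflow_exists G S L (@SG_flow _ _ _ S).
    split => //; last first.
      move=> g q [Uq Lq]; split; first exact: ultracopower_gact.
      by move=> k _; rewrite /preimage/= -gactM; exact: Lq.
    exists p; split => // g _.
    apply: (HC ((fun q => h (gact g q)) @^-1` [set r])).
      apply: (@closed_comp _ _ (fun q => h (gact g q))); last first.
        by apply: hausdorff_closed1; exact: Rhausdorff.
      move=> q _; apply: (@continuous_comp _ _ _ (gact g)); first exact: gact_continuousr.
      exact: ch.
    apply: filterS (filterI Ufin (Ug g)) => F [fF Fg].
    by rewrite /preimage/= SG_inj_gact hE/=; apply: Cr => //; exact: cC.
  exists M; split => //; first by move=> q /ML[].
  by move=> q /ML[_ /(_ 1%g I)]; rewrite /preimage/= gact1.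
have FA F (C : set X) g x : F g -> C x -> setact F C (gact g x).
  by move=> Fg Cx; exists g => //; exists x.
have [||M [mM MU M0]] := mk 0 A.
- by move=> F /AB[].
- move=> F g x fF Fg Ax; rewrite /phi; case: pselect => // _.
  by apply: dist_to0 => //; exact: FA.
have [||N [mN NU N1]] := mk 1 B.
- by move=> F /AB[].
- move=> F g x fF Fg Bx; rewrite /phi; case: pselect => // _.
  have [_ _ oB _ AB0] := AB F fF.
  (* The unit ball of [s] lies in [W], so its translates of [F A_F] miss [F B_F]. *)
  apply: (@dist_to1 _ _ _ _ _ (setact F (B F))); [exact: setact_open| |exact: FA].
  rewrite -subset0 => y [Ay By]; suff : (setact W (setact F (A F)) `&`
    setact W (setact F (B F))) y by rewrite AB0.
  split; first by apply: setactS Ay.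
  by exists 1%g; [case: sW|exists y; rewrite ?gact1].
have [L [_ uL]] := HU _ U S.
have [[[q Mq] _ _] _] := mM.
have Nq : N q by rewrite -(uL N (conj mN NU)) (uL M (conj mM MU)).
by have := M0 q Mq; rewrite N1// => /eqP; rewrite oner_eq0.
Qed.

Theorem theorem5p17 (R : realType) (G : topologicalGroupType)
    (G_hausdorff : hausdorff_space G) (G_regular : regular_space G)
    (X : gspace G) (X_flow : gflow X) (X_GED : GED X) :
  (minimal X ->
   [<-> rosendal_criterion X ;
        forall U : set G, symmetric_nbhd U ->
                  somewhere_TT U [set: X] ;
        thickness_condition X ;
        forall (I : Type) (U : beta I) (S : SG I X),
                  exists! M : set S,
                    minimal_subflow M /\ M `<=` ultracopower S U ;
        forall (I : Type) (U : beta I) (S : SG I X),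
                  highly_proximal (ultracopower S U) (SG_snd S) ;
        forall s : G -> R, SN s ->
                  dense (compatible (@dsn R G X s)) ;
        forall (s : G -> R) (s_SN : SN s),
                  dense (compatible (dsn_bar s_SN X_GED)) ;
        exists2 B : set (G -> R), seminorm_base B &
                  forall s, B s -> compatible (@dsn R G X s) !=set0 ])
  /\
  (topologically_transitive X ->
   [<-> rosendal_criterion X ;
        forall s : G -> R, SN s ->
                  dense (compatible (@dsn R G X s)) ;
        forall (s : G -> R) (s_SN : SN s),
                  dense (compatible (dsn_bar s_SN X_GED)) ]).
Proof.
have TT_compatible : (forall U : set G, symmetric_nbhd U -> somewhere_TT U [set: X]) ->
    minimal X -> forall s : G -> R, SN s -> dense (compatible (@dsn R G X s)).
  by move=> HTT mX; apply: rosendal_dense_compatible => //; exact: somewhere_TT_rosendal.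
split=> [mX|_].
  have X0 : [set: X] !=set0 by case: mX => -[].
  (* The passage from (4) to (2) through (3), needed both to reach (5) and to leave it. *)
  have unique_TT (HU : forall (I : Type) (U : beta I) (S : SG I X),
      exists! M : set S, minimal_subflow M /\ M `<=` ultracopower S U) :
      forall U : set G, symmetric_nbhd U -> somewhere_TT U [set: X].
    by apply: (thickness_somewhere_TT X0); exact: (@unique_minimal_thickness R).
  tfae.
  - by move=> RC U sU; apply: RC => //; exact: openT.
  - exact: somewhere_TT_thickness.
  - by move=> HT I U S; exact: (@thickness_unique_minimal _ _ _ S U R).
  - move=> HU I U S; apply: unique_minimal_highly_proximal => //; exact: unique_TT.
  - move=> HP; apply: (TT_compatible _ mX); apply: unique_TT => I U S.
    by apply: highly_proximal_unique_minimal => //; exact: HP.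
  - by move=> H s sSN; apply: dense_compatible_quotient; exact: H.
  (* The base consists of all bounded continuous semi-norms; compatible points in [X] itself are
     recovered from (7) by way of (1). *)
  - move=> H; exists (@SN R G); first exact: seminorm_base_SN.
    move=> s sSN; have RC := dense_compatible_quotient_rosendal H.
    have [x [_ cx]] := rosendal_dense_compatible X_flow RC sSN X0 openT.
    by exists x.
  - move=> [B bB HB]; apply: somewhere_TT_rosendal => //.
    exact: base_compatible_somewhere_TT bB HB.
tfae.
- exact: rosendal_dense_compatible.
- by move=> H s sSN; apply: dense_compatible_quotient; exact: H.
- exact: dense_compatible_quotient_rosendal.
Qed.
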